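(* Assume the setting of the context, with conditions (C.1)–(C.5), where $\lambda(x)=|x|^\beta/\beta$, $\beta\in(1,2)$, and assume $\mathbb{E}H_{Y,X}^\beta<\infty$. Let $\delta\in(0,1/2)$, put $C_{\delta,n,r}(p):=\log(\delta^{-2})+p\log(1+2nr_n)$, $$\alpha=\frac{1}{n^{1/\beta}}\Big[\frac{C_{\delta,n,r}(p)}{(2^{\beta-1}+1)R_{\lambda\circ l}(\Theta)}\Big]^{1/\beta},$$ and let $\hat\theta_n\in\arg\min_{\theta\in\Theta}\{\hat R_{\psi_\lambda,l,\alpha}(\theta)+\rho\|\theta\|_2^2\}$, where $\rho>0$ is the penalty parameter. Then, with probability at least $1-2\delta$, one has $$R_l(\hat\theta_n)-\inf_{\theta\in\Theta}R_l(\theta)\le\frac{2\,\mathbb{E}H_{Y,X}}{n}+C_{\beta,R_{\lambda\circ l}}\Big[\frac{C_{\delta,n,r}(p)}{n}\Big]^{\frac{\beta-1}{\beta}}+\rho\|\Theta^*\|_2^2=O\Big[\Big(\frac{p\log(nr_n)}{n}\Big)^{\frac{\beta-1}{\beta}}\Big]+\rho\|\Theta^*\|_2^2,$$ where $$C_{\beta,R_{\lambda\circ l}}:=\frac{2(2^{\beta-1}+1)R_{\lambda\circ l}(\Theta)+\frac{2^{\beta-1}}{\beta}\mathbb{E}H_{Y,X}^\beta}{[(2^{\beta-1}+1)R_{\lambda\circ l}(\Theta)]^{\frac{\beta-1}{\beta}}}.$$ Additionally, if the assumption $\mathbb{E}H_{Y,X}^\beta<\infty$ is replaced by $$\mathbb{E}H_{Y,X}=o(n),\qquad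 \mathbb{E}H_{Y,X}^\beta=O(n^\beta),$$ then the consistency of the excess risk is valid, i.e. $R_l(\hat\theta_n)-\inf_{\theta\in\Theta}R_l(\theta)=o_p(1)$.
   Context: Data and loss: $(X_1,Y_1),\dots,(X_n,Y_n)$ are i.i.d. copies of an $\mathbb{R}^d\times\mathbb{R}$-valued random variable $(X,Y)$. The loss is a real function $l(y,x,\theta)$, $y\in\mathbb{R}$, $x\in\mathbb{R}^d$, $\theta\in\Theta\subset\mathbb{R}^p$. Put $R_l(\theta)=\mathbb{E}[l(Y,X,\theta)]$; $\Theta^*$ is the set of all minimizers of $R_l$ over $\Theta$, and $\|\Theta^*\|_2:=\inf_{\theta^*\in\Theta^*}\|\theta^*\|_2$. Also $R_{\lambda\circ l}(\theta):=\mathbb{E}\{\lambda[l(Y,X,\theta)]\}$. Conditions: (C.1) $\lambda:\mathbb{R}_+\to\mathbb{R}_+$ is continuous and non-decreasing with $\lim_{x\to\infty}\lambda(x)/x=\infty$, and there are $c_2>0$ and $f:\mathbb{R}_+\to\mathbb{R}_+$ such that $\lambda(tx)\le f(t)\lambda(x)$ for all $t,x\in\mathbb{R}_+$ with $\lim_{t\to0^+}f(t)/t=0$, and $\lambda(x+y)\le c_2[\lambda(x)+\lambda(y)]$ for all $x,y\in\mathbb{R}_+$. (For $\lambda(x)=|x|^\beta/\beta$ this holds with $c_2=2^{\beta-1}$, $f(t)=t^\beta$.) (C.2) $\Theta\subseteq\mathbb{R}^p$ is convex and there is $r_n\in(0,\infty)$, which may depend on $n$, with $\|\theta\|_2\le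 r_n$ for all $\theta\in\Theta$. (C.3) There is a locally Lipschitz constant $H_{y,x}$ such that $|l(y,x,\theta_2)-l(y,x,\theta_1)|\le H_{y,x}\|\theta_2-\theta_1\|_2$ for all $\theta_1,\theta_2\in\Theta$. (C.4) $\mathbb{E}[\lambda(H_{Y,X})]<\infty$ (for $\lambda(x)=|x|^\beta/\beta$ this is the condition $\mathbb{E}H_{Y,X}^\beta<\infty$). (C.5) $R_{\lambda\circ l}(\Theta):=\sup_{\theta\in\Theta}R_{\lambda\circ l}(\theta)<\infty$. Truncation: $\psi_\lambda:\mathbb{R}\to\mathbb{R}$ is a non-decreasing function satisfying $-\log[1-x+\lambda(|x|)]\le\psi_\lambda(x)\le\log[1+x+\lambda(|x|)]$ for all $x\in\mathbb{R}$. For $\alpha>0$ (the robustification parameter), $\hat R_{\psi_\lambda,l,\alpha}(\theta):=\frac{1}{n\alpha}\sum_{i=1}^n\psi_\lambda[\alpha\, l(Y_i,X_i,\theta)]$. The dimension $p$ is allowed to grow with $n$.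
   Formalization: Consistency also assumes C_{δ,n,r}(p)/n→0, ρ‖Θ*‖²→0 and R_{λ∘l}(Θ) bounded in n (false for fixed large ρ); the O[...] assumes E H^β bounded, R_{λ∘l}(Θ) bounded and bounded away from 0, p≥1 and n r_n≥c>1 eventually (false if n r_n=1). *)

(* Defs.v *)
From HB Require Import structures.
From mathcomp Require Import all_boot all_order all_algebra.
From mathcomp Require Import all_classical all_reals all_analysis.

Set Implicit Arguments.
Unset Strict Implicit.
Unset Printing Implicit Defensive.

Import Order.TTheory GRing.Theory Num.Theory.
Import numFieldNormedType.Exports.

Local Open Scope classical_set_scope.
Local Open Scope ring_scope.

(* [T] with its Borel sigma-algebra. *)
Notation borel T := (g_sigma_algebraType (@open T)).

(* The norm [`|v|] of the library on ['rV[R]_p] is the maximum norm. *)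
Definition l2norm (R : realType) (p : nat) (v : 'rV[R]_p) : R :=
  Num.sqrt (\sum_(i < p) v ord0 i ^+ 2).

Definition argmin (R : realType) (T : Type) (D : set T) (f : T -> R) : set T :=
  [set t | D t /\ forall t', D t' -> f t <= f t'].

(* Inner probability: no measurability of [E], hence of an estimator that
   [E] involves, is needed.  For a measurable [E] this is [q%:E <= P E]. *)
Definition with_proba_ge (R : realType) (disp : measure_display)
    (Omega : measurableType disp) (P : probability Omega R)
    (q : R) (E : set Omega) : Prop :=
  exists A : set Omega,
    [/\ measurable A, A `<=` E & (q%:E <= P A)%E].

(* A statistical problem with [n] observations.  All the data, including the
   dimensions, the law of (X, Y) and the probability space, are fields, so that
   they may vary with [n] along a sequence [S : forall n, problem R n]. *)
Record problem (R : realType) (n : nat) := Problem {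
  disp : measure_display;
  Omega : measurableType disp;
  Pr : probability Omega R;
  dim_x : nat;
  dim_theta : nat;
  X : Omega -> 'rV[R]_dim_x;
  Y : Omega -> R;
  Xs : 'I_n -> Omega -> 'rV[R]_dim_x;
  Ys : 'I_n -> Omega -> R;
  Theta : set 'rV[R]_dim_theta;
  theta_radius : R;
  loss : R -> 'rV[R]_dim_x -> 'rV[R]_dim_theta -> R;
  lip : R -> 'rV[R]_dim_x -> R
}.

Arguments disp {R n} M : rename.
Arguments Omega {R n} M : rename.
Arguments Pr {R n} M : rename.
Arguments dim_x {R n} M : rename.
Arguments dim_theta {R n} M : rename.
Arguments X {R n} M _ : rename.
Arguments Y {R n} M _ : rename.
Arguments Xs {R n} M _ _ : rename.
Arguments Ys {R n} M _ _ : rename.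
Arguments Theta {R n} M _ : rename.
Arguments theta_radius {R n} M : rename.
Arguments loss {R n} M _ _ _ : rename.
Arguments lip {R n} M _ _ : rename.

Section Problem.
Variables (R : realType) (n : nat) (M : problem R n).

Local Notation XY := (borel ('rV[R]_(dim_x M) * R)%type).

Definition pairXY (w : Omega M) : XY := (X M w, Y M w).
Definition sampleXY (i : 'I_n) (w : Omega M) : XY := (Xs M i w, Ys M i w).

(* For the independence of finitely many random elements, the product rule
   over all indices is enough: take [A i = setT] outside a subfamily. *)
Definition iid_sample : Prop :=
  [/\ measurable_fun [set: Omega M] pairXY,
      forall i, measurable_fun [set: Omega M] (sampleXY i),
      forall i (A : set XY), measurable A ->
        Pr M (sampleXY i @^-1` A) = Pr M (pairXY @^-1` A)
    & forall A : 'I_n -> set XY, (forall i, measurable (A i)) ->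
        Pr M (\bigcap_i (sampleXY i @^-1` A i)) =
        (\prod_(i < n) Pr M (sampleXY i @^-1` A i))%E].

Definition measurable_loss : Prop :=
  forall theta, Theta M theta ->
    measurable_fun [set: XY] (fun z : XY => loss M z.2 z.1 theta).

(* The law of the Lipschitz constant enters the moment conditions, so it is
   a random variable; as the argument of lambda it is nonnegative. *)
Definition measurable_lip : Prop :=
  (forall y x, 0 <= lip M y x) /\
  measurable_fun [set: XY] (fun z : XY => lip M z.2 z.1).

Definition bounded_convex_Theta : Prop :=
  [/\ convex_set (Theta M), 0 < theta_radius M
    & forall theta, Theta M theta -> l2norm theta <= theta_radius M].

Definition lipschitz_loss : Prop :=
  forall y x theta1 theta2, Theta M theta1 -> Theta M theta2 ->
    `|loss M y x theta2 - loss M y x theta1|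
      <= lip M y x * l2norm (theta2 - theta1).

Definition lossXY (theta : 'rV[R]_(dim_theta M)) (w : Omega M) : R :=
  loss M (Y M w) (X M w) theta.

Definition lipXY (w : Omega M) : R := lip M (Y M w) (X M w).

Definition risk (theta : 'rV[R]_(dim_theta M)) : R := fine 'E_(Pr M)[lossXY theta].

Definition excess_risk (theta : 'rV[R]_(dim_theta M)) : R :=
  risk theta - inf (risk @` Theta M).

(* The norm of the set of all risk minimizers; it is [+oo] if there is none. *)
Definition l2norm_minimizers : \bar R :=
  ereal_inf [set (l2norm theta)%:E | theta in argmin (Theta M) risk].

Section Lambda.
Variable lambda : R -> R.

Definition lambda_risk (theta : 'rV[R]_(dim_theta M)) : \bar R :=
  'E_(Pr M)[fun w => lambda (lossXY theta w)].

Definition sup_lambda_risk : \bar R :=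
  ereal_sup (lambda_risk @` Theta M).

(* The conditions, except for the moment condition on the Lipschitz
   constant. *)
Definition regular_problem : Prop :=
  [/\ iid_sample, measurable_loss, measurable_lip, bounded_convex_Theta
    & lipschitz_loss /\ (sup_lambda_risk < +oo)%E].

End Lambda.

Definition truncated_risk (psi : R -> R) (alpha : R) (theta : 'rV[R]_(dim_theta M))
    (w : Omega M) : R :=
  (n%:R * alpha)^-1 *
  \sum_(i < n) psi (alpha * loss M (Ys M i w) (Xs M i w) theta).

Definition ridge_argmin (psi : R -> R) (alpha rho : R) (w : Omega M) :
    set 'rV[R]_(dim_theta M) :=
  argmin (Theta M)
    (fun theta => truncated_risk psi alpha theta w + rho * l2norm theta ^+ 2).

End Problem.

Arguments risk {R n} M _.
Arguments lipXY {R n} M _.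

Definition truncation (R : realType) (lambda psi : R -> R) : Prop :=
  {homo psi : x y / x <= y} /\
  forall x, - ln (1 - x + lambda `|x|) <= psi x <= ln (1 + x + lambda `|x|).

Definition power_lambda (R : realType) (beta x : R) : R := `|x| `^ beta / beta.

Section Constants.
Variables (R : realType) (beta delta : R) (n : nat) (M : problem R n).

(* The finite value of the supremum of the lambda-risk. *)
Definition Rlam : R := fine (sup_lambda_risk M (power_lambda beta)).

Definition lip_mean : \bar R := 'E_(Pr M)[lipXY M].

Definition lip_moment : \bar R := 'E_(Pr M)[fun w => lipXY M w `^ beta].

Definition complexity : R :=
  ln (delta ^- 2) + (dim_theta M)%:R * ln (1 + 2 * n%:R * theta_radius M).

(* If [Rlam = 0], then [alpha_opt = 0] by the convention [x / 0 = 0]. *)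
Definition alpha_opt : R :=
  (n%:R `^ beta^-1)^-1 *
  (complexity / ((2 `^ (beta - 1) + 1) * Rlam)) `^ beta^-1.

Definition excess_const : R :=
  (2 * (2 `^ (beta - 1) + 1) * Rlam
     + 2 `^ (beta - 1) / beta * fine lip_moment)
  / ((2 `^ (beta - 1) + 1) * Rlam) `^ ((beta - 1) / beta).

Definition excess_bound : R :=
  2 * fine lip_mean / n%:R
  + excess_const * (complexity / n%:R) `^ ((beta - 1) / beta).

End Constants.

(* Main.v *)
Require Import Defs.
From HB Require Import structures.
From mathcomp Require Import all_boot all_order all_algebra.
From mathcomp Require Import finmap.
From mathcomp Require Import all_classical all_reals all_analysis.
From mathcomp Require Import measurable_realfun ring lra.

(** Cover [Theta] by a [1/n]-net of at most [(1 + 2 n r)^p] points.  The upper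
envelope [ln (1 + x + lambda |x|)] of [psi] turns [exp (sum psi)] into a product
of independent factors of mean [1 + alpha E l + alpha^beta E lambda(l)], so that
Chernoff's method bounds the truncated risk from above at one minimizer of the
risk, and, applied to [lip / n - l] at each point of the net, from below over the
whole of [Theta], since [psi] is monotone.  Comparing the two at the penalized
minimizer and choosing [alpha] gives the bound.

The size of the net is a volume comparison: if disjoint balls lie in a ball,
then the sum of their volumes is at most its volume.  This is proved by induction
on the dimension, by integrating over the hyperplane sections, which are again
disjoint balls inside a ball; only the Lebesgue measure of the line is needed.

Three degenerate situations need care.  The infimum of the norms of the
minimizers need not be attained: the bound at a minimizing sequence of
minimizers is passed to the limit along the upper limit of the events.  If the
lambda-risk vanishes, then [alpha = 0], but all the losses vanish almost surely.
For the consistency, neither is the lambda-risk bounded away from 0 (if it is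
small, then so is the excess risk of every parameter), nor does [delta n] tend to
0: the estimator, although tuned with [delta n], is analyzed at the confidence
level [eta / 2], which multiplies the complexity by a constant factor only. *)

Set Implicit Arguments.
Unset Strict Implicit.
Unset Printing Implicit Defensive.

Import Order.TTheory GRing.Theory Num.Theory.
Import numFieldNormedType.Exports.

Local Open Scope classical_set_scope.
Local Open Scope ring_scope.

(** * Packing numbers of Euclidean balls *)

Section packing.
Variable R : realType.
Implicit Types (p : nat) (q s t u c : R).

Let mu := (@lebesgue_measure R).

(** Points are functions on [nat] of which only the first [p] coordinates count, so that an
    induction on the dimension does not change their type. *)
Definition sqdist p (x c : nat -> R) : R := \sum_(k < p) (x k - c k) ^+ 2.

(* Up to the volume of the unit ball, the volume of a closed ball of squared
   radius [q] in dimension [p]; the ball is empty if [q < 0]. *)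
Definition ball_volume p q : R := if 0 <= q then Num.sqrt q ^+ p else 0.

Lemma ball_volume_ge0 p q : 0 <= ball_volume p q.
Proof. by rewrite /ball_volume; case: ifP => // _; rewrite exprn_ge0 ?sqrtr_ge0. Qed.

Lemma measurable_ball_volume p : measurable_fun [set: R] (ball_volume p).
Proof.
apply: measurable_fun_ifT => //.
- by apply: measurable_fun_ler => //.
- apply: (@measurableT_comp _ _ _ _ _ _ (fun x : R => x ^+ p)).
    exact: exprn_measurable.
  exact: continuous_measurable_fun (@sqrt_continuous R).
Qed.

(** The ratio of the volumes of the unit balls in dimensions [p + 1] and [p]. Its value is
    irrelevant; being positive and finite, it can be cancelled. *)
Definition slice_const p : \bar R :=
  \int[mu]_(u in `[(-1)%R, 1%R]) (Num.sqrt (1 - u ^+ 2) ^+ p)%:E.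

Let continuous_slice p q c : continuous (fun t : R => Num.sqrt (q - (t - c) ^+ 2) ^+ p).
Proof.
move=> t.
apply: (@continuous_comp _ _ _ (fun t : R => Num.sqrt (q - (t - c) ^+ 2))
  (fun x : R => x ^+ p)); last exact: exprn_continuous.
apply: (@continuous_comp _ _ _ (fun t : R => q - (t - c) ^+ 2) Num.sqrt);
  last exact: sqrt_continuous.
apply: cvgB; first exact: cvg_cst.
apply: (@continuous_comp _ _ _ (fun t : R => t - c) (fun x : R => x ^+ 2));
  last exact: exprn_continuous.
by apply: cvgB; [exact: cvg_id|exact: cvg_cst].
Qed.

Let measurable_slice p q c (D : set R) :
  measurable_fun D (fun t : R => (Num.sqrt (q - (t - c) ^+ 2) ^+ p)%:E).
Proof.
apply/measurable_EFinP; apply: measurable_funTS.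
by apply: continuous_measurable_fun; exact: continuous_slice.
Qed.

Let measurable_slice0 p (D : set R) :
  measurable_fun D (fun u : R => (Num.sqrt (1 - u ^+ 2) ^+ p)%:E).
Proof.
rewrite (_ : (fun u : R => _) = (fun u : R => (Num.sqrt (1 - (u - 0) ^+ 2) ^+ p)%:E)).
  exact: measurable_slice.
by apply/funext => u; rewrite subr0.
Qed.

Lemma slice_const_gt0 p : (0 < slice_const p)%E.
Proof.
(* For [|u| <= 1/2] the root is at least [1/2], because [1 - u^2 >= 1/4]. *)
apply: (@lt_le_trans _ _ (\int[mu]_(u in `[(- 2^-1)%R, (2^-1)%R]) (2^-1 ^+ p)%:E)%E).
  rewrite integral_cst//= lebesgue_measure_itv/= lte_fin.
  rewrite ifT; last by lra.
  by rewrite -EFinD -EFinM lte_fin mulr_gt0 ?exprn_gt0//; lra.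
apply: (@le_trans _ _ (\int[mu]_(u in `[(- 2^-1)%R, (2^-1)%R]) (Num.sqrt (1 - u ^+ 2) ^+ p)%:E)%E).
  apply: ge0_le_integral => //.
  - exact: measurable_slice0.
  - move=> u; rewrite /= in_itv/= => /andP[u1 u2].
    rewrite lee_fin lerXn2r// ?nnegrE ?sqrtr_ge0//.
    have -> : 2^-1 = Num.sqrt (2^-1 ^+ 2) :> R by rewrite sqrtr_sqr ger0_norm.
    by rewrite ler_wsqrtr//; nra.
apply: ge0_subset_integral => //=.
- exact: measurable_slice0.
- by move=> u /=; rewrite !in_itv/= => /andP[? ?]; apply/andP; split; lra.
Qed.

Lemma slice_const_fin p : slice_const p \is a fin_num.
Proof.
rewrite ge0_fin_numE; last exact/ltW/slice_const_gt0.
apply: (@le_lt_trans _ _ (\int[mu]_(u in `[(-1)%R, 1%R]) 1%:E)%E).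
  apply: ge0_le_integral => //.
  - exact: measurable_slice0.
  - move=> u _; rewrite lee_fin exprn_ile1 ?sqrtr_ge0//.
    rewrite -[leRHS]sqrtr1 ler_wsqrtr//; nra.
rewrite integral_cst//= lebesgue_measure_itv/= lte_fin.
by case: ifP; rewrite ?mule0// -EFinD -EFinM ltry.
Qed.

(** Cavalieri's principle: the section at height [t] of a ball of squared radius [q] has squared
    radius [q - (t - c)^2]. With [s = sqrt q], the substitution [t = c + s u] takes out a factor
    [s^(p+1)]. *)
Lemma integral_slice p q (c : R) :
  (\int[mu]_t (ball_volume p (q - (t - c) ^+ 2))%:E =
   (ball_volume p.+1 q)%:E * slice_const p)%E.
Proof.
have [q0|q0] := ltP q 0.
  rewrite {2}/ball_volume leNgt q0 mul0e.
  apply: integral0_eq => t _; rewrite /ball_volume ifF//.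
  by apply/negbTE; rewrite -ltNge subr_lt0 (lt_le_trans q0)// sqr_ge0.
rewrite {2}/ball_volume q0.
set s := Num.sqrt q; have s0 : 0 <= s by exact: sqrtr_ge0.
have qE : q = s ^+ 2 by rewrite sqr_sqrtr.
transitivity (\int[mu]_(t in `[(c - s)%R, (c + s)%R])
    (Num.sqrt (q - (t - c) ^+ 2) ^+ p)%:E)%E.
  rewrite [RHS]integral_mkcond; apply: eq_integral => t _.
  rewrite patchE /ball_volume.
  have -> : (t \in [set` `[(c - s)%R, (c + s)%R]]) = (0 <= q - (t - c) ^+ 2).
    rewrite mem_setE in_itv/= {1}qE subr_ge0 -[X in _ = (X <= _)]real_normK ?num_real//.
    by rewrite ler_pXn2r ?nnegrE// ler_distl.
  by case: ifP.
(* For radius 0 the integral is over one point; the substitution requires [s > 0]. *)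
have [s_eq0|s_gt0] := eqVneq s 0.
  rewrite s_eq0 subr0 addr0 exprS mul0r mul0e set_itv1 integral_set1//.
have {}s_gt0 : 0 < s by rewrite lt_neqAle eq_sym s_gt0.
pose F u : R := c + s * u.
have -> : c - s = F (-1) by rewrite /F; ring.
have -> : c + s = F 1 by rewrite /F; ring.
have dM u : derivable (fun v : R => s * v) u 1 by apply: derivableM.
have dF u : derivable F u 1 by apply: derivableD.
have F' : F^`()%classic = cst s.
  apply/funext => u; rewrite derive1E (_ : F = cst c + (fun v => s * v))//.
  by rewrite deriveD// derive_cst add0r -derive1E derive1Ml// derive1_id mulr1.
have cF : continuous F.
  move=> u; apply: cvgD; first exact: cvg_cst.
  by apply: cvgM; [exact: cvg_cst|exact: cvg_id].
rewrite (@integration_by_substitution_increasing _ F); last first.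
- apply: continuous_subspaceT; exact: continuous_slice.
- by split => //; [exact/cvg_at_right_filter/cF|exact/cvg_at_left_filter/cF].
- by rewrite F'; exact: is_cvg_cst.
- by rewrite F'; exact: is_cvg_cst.
- by rewrite F' => ? _; exact: cvg_cst.
- by move=> u v _ _ uv; rewrite /F ltrD2l ltr_pM2l.
- lra.
rewrite F' -ge0_integralZl_EFin//.
- apply: eq_integral => u _ /=; rewrite -EFinM; congr EFin; rewrite fctE/= /F.
  have -> : q - (c + s * u - c) ^+ 2 = s ^+ 2 * (1 - u ^+ 2) by rewrite {1}qE; ring.
  by rewrite sqrtrM ?sqr_ge0// sqrtr_sqr ger0_norm// exprMn mulrAC -exprSr.
- exact: measurable_slice0.
- by rewrite exprn_ge0.
Qed.

(** Squared radii may be negative, since a hyperplane can miss a ball. The sections at each height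
    satisfy both hypotheses one dimension lower; the induction hypothesis is integrated over the
    height. *)
Lemma packing p N (c : 'I_N -> nat -> R) (q : 'I_N -> R) Q :
    (forall x i, sqdist p x (c i) <= q i -> sqdist p x (fun=> 0) <= Q) ->
    (forall x i j, sqdist p x (c i) <= q i -> sqdist p x (c j) <= q j -> i = j) ->
  \sum_i ball_volume p (q i) <= ball_volume p Q.
Proof.
elim: p c q Q => [|p IHp] c q Q incl disj.
  (* Dimension 0: the space is one point, so disjointness leaves at most one nonempty ball, and a
     nonempty ball has volume 1. *)
  have [[i qi]|noi] := pselect (exists i, 0 <= q i); last first.
    rewrite big1 ?ball_volume_ge0// => i _.
    by rewrite /ball_volume; case: ifPn => // qi; exfalso; apply: noi; exists i.
  rewrite (bigD1 i)//= big1 ?addr0 => [|j ji].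
    rewrite /ball_volume qi ifT//.
    by have := incl (fun=> 0) i; rewrite /sqdist !big_ord0; apply.
  rewrite /ball_volume; case: ifPn => // qj.
  have := disj (fun=> 0) i j; rewrite /sqdist !big_ord0 => /(_ qi qj) ij.
  by rewrite ij eqxx in ji.
pose ext (x : nat -> R) t k := if k == p then t else x k.
have sqdist_ext x t (d : nat -> R) :
    sqdist p.+1 (ext x t) d = sqdist p x d + (t - d p) ^+ 2.
  rewrite /sqdist big_ord_recr/= {2}/ext eqxx; congr (_ + _).
  by apply: eq_bigr => k _; rewrite /ext ltn_eqF.
have slice t : \sum_i ball_volume p (q i - (t - c i p) ^+ 2) <=
               ball_volume p (Q - (t - 0) ^+ 2).
  apply: (IHp c) => [x i|x i j].
  - rewrite !lerBrDr -(sqdist_ext _ _ (c i)) -(sqdist_ext _ _ (fun=> 0)).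
    exact: incl.
  - by rewrite !lerBrDr -(sqdist_ext _ _ (c i)) -(sqdist_ext _ _ (c j)); exact: disj.
have mslice (r d : R) : measurable_fun [set: R]
    (fun t => (ball_volume p (r - (t - d) ^+ 2))%:E).
  apply/measurable_EFinP; apply: measurableT_comp; first exact: measurable_ball_volume.
  apply: measurable_funB => //; apply: measurable_funX.
  exact: measurable_funB.
suff : ((\sum_i ball_volume p.+1 (q i))%:E * slice_const p <=
        (ball_volume p.+1 Q)%:E * slice_const p)%E.
  rewrite -(fineK (slice_const_fin p)) -!EFinM lee_fin ler_pM2r//.
  by rewrite fine_gt0// slice_const_gt0/= ltey_eq slice_const_fin.
rewrite -(integral_slice _ _ 0) -sumEFin ge0_sume_distrl; last first.
  by move=> i _; rewrite lee_fin ball_volume_ge0.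
under eq_bigr => i _ do rewrite -(integral_slice _ _ (c i p)).
rewrite -ge0_integral_sum//; last 2 first.
- by move=> i; exact: mslice.
- by move=> i t _; rewrite lee_fin ball_volume_ge0.
apply: ge0_le_integral => //.
- by move=> t _; apply: sume_ge0 => i _; rewrite lee_fin ball_volume_ge0.
- by apply: emeasurable_sum => i; exact: mslice.
- exact: mslice.
- by move=> t _; rewrite sumEFin lee_fin slice.
Qed.

End packing.

(** * Euclidean norm, separated sets and nets *)

Section net.
Variable R : realType.
Implicit Types (p : nat) (r e : R).

Lemma l2norm_ge0 p (v : 'rV[R]_p) : 0 <= l2norm v.
Proof. exact: sqrtr_ge0. Qed.

Lemma sqr_l2norm p (v : 'rV[R]_p) : l2norm v ^+ 2 = \sum_(i < p) v ord0 i ^+ 2.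
Proof. by rewrite sqr_sqrtr// sumr_ge0// => i _; rewrite sqr_ge0. Qed.

Lemma l2normN p (v : 'rV[R]_p) : l2norm (- v) = l2norm v.
Proof. by congr Num.sqrt; apply: eq_bigr => i _; rewrite mxE sqrrN. Qed.

Lemma l2norm_dot p (u v : 'rV[R]_p) :
  \sum_(i < p) u ord0 i * v ord0 i <= l2norm u * l2norm v.
Proof.
set a := l2norm u; set b := l2norm v.
have [ab0|ab0] := eqVneq (a * b) 0.
  rewrite ab0 big1// => i _; apply/eqP; rewrite mulf_eq0.
  have zero (w : 'rV[R]_p) : l2norm w = 0 -> w ord0 i == 0.
    move=> w0; have /eqP := sqr_l2norm w; rewrite w0 expr0n eq_sym psumr_eq0.
      by move=> /allP/(_ i (mem_index_enum _)); rewrite sqrf_eq0.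
    by move=> j _; rewrite sqr_ge0.
  move/eqP: ab0; rewrite mulf_eq0 => /orP[] /eqP/zero ->//.
  by rewrite orbT.
have {}ab0 : 0 < a * b by rewrite lt_neqAle eq_sym ab0 mulr_ge0 ?l2norm_ge0.
(* [2 a b <u, v> = a^2 |v|^2 + b^2 |u|^2 - |a v - b u|^2] *)
have : 0 <= \sum_(i < p) (a * v ord0 i - b * u ord0 i) ^+ 2.
  by apply: sumr_ge0 => i _; rewrite sqr_ge0.
have -> : \sum_(i < p) (a * v ord0 i - b * u ord0 i) ^+ 2 =
    a ^+ 2 * (\sum_(i < p) v ord0 i ^+ 2) + b ^+ 2 * (\sum_(i < p) u ord0 i ^+ 2)
    - 2 * (a * b) * \sum_(i < p) u ord0 i * v ord0 i.
  rewrite !mulr_sumr -!big_split/= -sumrB; apply: eq_bigr => i _; ring.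
rewrite -!sqr_l2norm -/a -/b.
have -> : a ^+ 2 * b ^+ 2 + b ^+ 2 * a ^+ 2 - 2 * (a * b) *
    (\sum_(i < p) u ord0 i * v ord0 i) =
    2 * (a * b) * (a * b - \sum_(i < p) u ord0 i * v ord0 i) by ring.
by rewrite pmulr_rge0 ?subr_ge0// mulr_gt0.
Qed.

Lemma l2normD p (u v : 'rV[R]_p) : l2norm (u + v) <= l2norm u + l2norm v.
Proof.
rewrite -(@ler_pXn2r _ 2)// ?nnegrE ?addr_ge0 ?l2norm_ge0//.
rewrite sqr_l2norm sqrrD !sqr_l2norm.
have -> : \sum_(i < p) (u + v) ord0 i ^+ 2 = \sum_(i < p) u ord0 i ^+ 2 +
    (\sum_(i < p) u ord0 i * v ord0 i) *+ 2 + \sum_(i < p) v ord0 i ^+ 2.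
  rewrite -sumrMnl -!big_split/=; apply: eq_bigr => i _; rewrite mxE; ring.
by rewrite lerD2r lerD2l lerMn2r l2norm_dot.
Qed.

Definition l2_separated p e (s : seq 'rV[R]_p) :=
  forall i j, (i < size s)%N -> (j < size s)%N -> i != j ->
    e < l2norm (s`_i - s`_j).

(** The balls of radius [e / 2] around the points are disjoint and lie in the ball of radius
    [r + e / 2] around 0; the bound is the quotient of the volumes. *)
Lemma size_l2_separated p r e (s : seq 'rV[R]_p) : 0 < e -> 0 < r ->
    (forall i, (i < size s)%N -> l2norm s`_i <= r) -> l2_separated e s ->
  (size s)%:R <= (1 + 2 * r / e) ^+ p.
Proof.
move=> e0 r0 sr seps.
pose c (i : 'I_(size s)) (k : nat) : R := if insub k is Some k' then s`_i ord0 k' else 0.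
pose row_of (x : nat -> R) : 'rV[R]_p := \row_k x k.
have sqdistE x i : sqdist p x (c i) = l2norm (row_of x - s`_i) ^+ 2.
  rewrite sqr_l2norm; apply: eq_bigr => k _; rewrite !mxE /c.
  by rewrite valK.
have sqdist0E x : sqdist p x (fun=> 0) = l2norm (row_of x) ^+ 2.
  by rewrite sqr_l2norm; apply: eq_bigr => k _; rewrite !mxE subr0.
have h0 : 0 <= e / 2 by rewrite divr_ge0// ltW.
have ball_le (v : 'rV[R]_p) t : 0 <= t -> (l2norm v ^+ 2 <= t ^+ 2) = (l2norm v <= t).
  by move=> t0; rewrite ler_pXn2r// nnegrE l2norm_ge0.
have := @packing R p _ c (fun=> (e / 2) ^+ 2) ((r + e / 2) ^+ 2).
rewrite sumr_const card_ord /ball_volume !sqr_ge0 !sqrtr_sqr !ger0_norm//; last first.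
  by rewrite addr_ge0// ltW.
move=> pack.
have : (e / 2) ^+ p *+ size s <= (r + e / 2) ^+ p.
  apply: pack => [x i|x i j].
  - rewrite sqdistE sqdist0E !ball_le// ?addr_ge0// ?(ltW r0)// => xi.
    have -> : row_of x = s`_i + (row_of x - s`_i) by rewrite addrC subrK.
    by rewrite (le_trans (l2normD _ _))// lerD// sr.
  - rewrite !sqdistE !ball_le// => xi xj; apply/eqP; apply: contraT => ij.
    have := seps i j (ltn_ord i) (ltn_ord j) ij.
    rewrite ltNge => /negP; case.
    have -> : s`_i - s`_j = - (row_of x - s`_i) + (row_of x - s`_j).
      by rewrite opprB addrA subrK.
    by rewrite (le_trans (l2normD _ _))// l2normN; lra.
rewrite -mulr_natl -ler_pdivlMr ?exprn_gt0 ?divr_gt0//.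
rewrite -expr_div_n (_ : (r + e / 2) / (e / 2) = 1 + 2 * r / e)//.
by field; rewrite gt_eqF.
Qed.

(** A longest [e]-separated sequence in [A] is a net: a point farther than [e] from all its members
    could be added. The net stays inside [A], where the loss is Lipschitz. *)
Lemma exists_net p r e (A : set 'rV[R]_p) : 0 < e -> 0 < r ->
    (forall v, A v -> l2norm v <= r) ->
  exists s : seq 'rV[R]_p, [/\ (size s)%:R <= (1 + 2 * r / e) ^+ p,
    forall i, (i < size s)%N -> A s`_i &
    forall v, A v -> exists2 i, (i < size s)%N & l2norm (v - s`_i) <= e].
Proof.
move=> e0 r0 Ar.
pose Q k := `[< exists s : seq 'rV[R]_p, [/\ size s = k,
  forall i, (i < size s)%N -> A s`_i & l2_separated e s] >].
have Q0 : exists k, Q k by exists 0%N; apply/asboolP; exists [::].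
have Qub k : Q k -> (k <= Num.truncn ((1 + 2 * r / e) ^+ p))%N.
  move=> /asboolP[s [<- sA sep]].
  rewrite truncn_ge_nat; last by rewrite exprn_ge0// addr_ge0// divr_ge0 ?mulr_ge0// ltW.
  by apply: size_l2_separated => // i /sA; exact: Ar.
case: (ex_maxnP Q0 Qub) => k /asboolP[s [sk sA sep]] kmax.
exists s; split => //; first by apply: size_l2_separated => // i /sA; exact: Ar.
move=> v Av; apply: contrapT => nov.
have far i : (i < size s)%N -> e < l2norm (v - s`_i).
  by move=> si; rewrite ltNge; apply/negP => ve; apply: nov; exists i.
suff : (k.+1 <= k)%N by rewrite ltnn.
apply: kmax; apply/asboolP; exists (v :: s); split => /=; first by rewrite sk.
  by case=> //= i /sA.
move=> [|i] [|j]//= si sj ij.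
- exact: far.
- by rewrite -l2normN opprB; exact: far.
- exact: sep.
Qed.

End net.

(** * The power function lambda *)

Section power_lambda.
Variables (R : realType) (beta : R).
Hypothesis beta1 : 1 < beta.

Let beta0 : 0 < beta. Proof. exact: lt_trans beta1. Qed.

Lemma power_lambda_ge0 (x : R) : 0 <= power_lambda beta x.
Proof. by rewrite /power_lambda divr_ge0 ?powR_ge0// ltW. Qed.

Lemma power_lambda_norm (x : R) : power_lambda beta `|x| = power_lambda beta x.
Proof. by rewrite /power_lambda normr_id. Qed.

Lemma power_lambdaN (x : R) : power_lambda beta (- x) = power_lambda beta x.
Proof. by rewrite /power_lambda normrN. Qed.

Lemma power_lambdaM (a x : R) : 0 <= a ->
  power_lambda beta (a * x) = a `^ beta * power_lambda beta x.
Proof.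
by move=> a0; rewrite /power_lambda normrM (ger0_norm a0) powRM// mulrA.
Qed.

(** Keeps the argument of [ln] in the envelopes of [psi] positive, where [ln] inverts [expR]. *)
Lemma power_lambda_gt0 (x : R) : 0 < 1 + x + power_lambda beta x.
Proof.
have b1 : 0 < beta - 1 by rewrite subr_gt0.
(* Young's inequality for [|x| * 1] *)
have := @conjugate_powR R `|x| 1 beta (beta / (beta - 1)) (normr_ge0 x) ler01 beta0.
rewrite divr_gt0// powR1 mulr1 invf_div mul1r.
have -> : beta^-1 + (beta - 1) / beta = 1 by field; rewrite gt_eqF.
move=> /(_ isT erefl); rewrite -/(power_lambda beta x).
have -> : (beta - 1) / beta = 1 - beta^-1 by field; rewrite gt_eqF.
have : 0 < beta^-1 by rewrite invr_gt0.
by have := ler_norm (- x); rewrite normrN; lra.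
Qed.

(** Convexity of the power at the midpoint of [2 |x|] and [2 |y|]. *)
Lemma power_lambdaD (x y : R) :
  power_lambda beta (x + y) <=
  2 `^ (beta - 1) * (power_lambda beta x + power_lambda beta y).
Proof.
rewrite /power_lambda -mulrDl mulrA ler_pM2r ?invr_gt0//.
apply: (@le_trans _ _ ((`|x| + `|y|) `^ beta)).
  by rewrite ge0_ler_powR ?nnegrE ?ler_normD ?addr_ge0// ltW.
have mem0 (z : R) : 0 <= z -> z \in (`[0, +oo[%classic : set R).
  by move=> z0; apply: mem_set; rewrite /= in_itv/= z0.
have half0 : (0 : R) <= 2^-1 by [].
have half1 : (2^-1 : R) <= 1 by rewrite invf_le1 ?ler1n.
have x0 : 0 <= 2 * `|x| by rewrite mulr_ge0.
have y0 : 0 <= 2 * `|y| by rewrite mulr_ge0.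
have : (2^-1 * (2 * `|x|) + 2^-1 * (2 * `|y|)) `^ beta <=
    2^-1 * (2 * `|x|) `^ beta + 2^-1 * (2 * `|y|) `^ beta :> R.
  rewrite {2 4}(_ : 2^-1 = 1 - 2^-1); last by lra.
  exact: (convex_powR (ltW beta1) (Itv01 half0 half1) (mem0 _ x0) (mem0 _ y0)).
have -> : 2^-1 * (2 * `|x|) = `|x| by field.
have -> : 2^-1 * (2 * `|y|) = `|y| by field.
move=> /le_trans; apply.
rewrite !powRM// -!mulrDr mulrA powRB//; last by rewrite pnatr_eq0 implybT.
by rewrite powRr1// [2^-1 * _]mulrC.
Qed.

Lemma measurable_power_lambda d (T : measurableType d) (f : T -> R) :
  measurable_fun setT f -> measurable_fun setT (fun t => power_lambda beta (f t)).
Proof.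
move=> mf; apply: measurable_funM => //.
apply: (@measurableT_comp _ _ _ _ _ _ (@powR R ^~ beta)).
  exact: measurable_powR.
by apply: measurableT_comp => //; exact: normr_measurable.
Qed.

(** If [|x| > s], then [|x| = |x|^(1 - beta) |x|^beta <= s^(1 - beta) |x|^beta]. The free level [s]
    makes the first moment small when the lambda-moment is small. *)
Lemma norm_le_power_lambda (s x : R) : 0 < s ->
  `|x| <= s + s `^ (1 - beta) * beta * power_lambda beta x.
Proof.
move=> s0.
have -> : s `^ (1 - beta) * beta * power_lambda beta x = s `^ (1 - beta) * `|x| `^ beta.
  by rewrite /power_lambda -mulrA; congr (_ * _); field; rewrite gt_eqF.
have [xs|sx] := leP `|x| s.
  by rewrite (le_trans xs)// lerDl mulr_ge0 ?powR_ge0.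
have x0 : 0 < `|x| by exact: lt_trans sx.
apply: (@le_trans _ _ (s `^ (1 - beta) * `|x| `^ beta)); last first.
  by rewrite lerDr ltW.
have -> : `|x| `^ beta = `|x| `^ (beta - 1) * `|x|.
  rewrite -[X in _ = _ * X](powRr1 (normr_ge0 x)) -powRD ?subrK//.
  by rewrite gt_eqF// implybT.
rewrite mulrA ler_peMl//.
have -> : 1 - beta = - (beta - 1) by ring.
rewrite powRN ler_pdivlMl ?powR_gt0// mulr1 ge0_ler_powR ?nnegrE//.
- by rewrite subr_ge0 ltW.
- exact: ltW.
- exact: ltW.
Qed.

Lemma integrable_power_lambda d (T : measurableType d) (P : probability T R)
    (f : T -> R) (v s : R) : 0 < s -> measurable_fun setT f ->
    (\int[P]_t (power_lambda beta (f t))%:E <= v%:E)%E ->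
  P.-integrable setT (EFin \o f) /\
  (\int[P]_t `|(f t)%:E| <= (s + s `^ (1 - beta) * beta * v)%:E)%E.
Proof.
move=> s0 mf fv.
have mfa : measurable_fun setT (fun t => `|(f t)%:E|%E).
  by apply: measurableT_comp => //; exact/measurable_EFinP.
have H : (\int[P]_t `|(f t)%:E| <= (s + s `^ (1 - beta) * beta * v)%:E)%E.
  have c0 : 0 <= s `^ (1 - beta) * beta by rewrite mulr_ge0 ?powR_ge0// ltW.
  have ml : measurable_fun setT (fun t => (power_lambda beta (f t))%:E).
    by apply/measurable_EFinP; exact: measurable_power_lambda.
  apply: (@le_trans _ _ (\int[P]_t (s%:E + (s `^ (1 - beta) * beta)%:E *
      (power_lambda beta (f t))%:E))%E).
    apply: ge0_le_integral => //.
    - by apply: emeasurable_funD => //; exact: measurable_funeM.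
    - by move=> t _; rewrite -EFinM -EFinD abse_EFin lee_fin norm_le_power_lambda.
  rewrite ge0_integralD//; last 3 first.
  - by move=> t _; rewrite lee_fin ltW.
  - by move=> t _; rewrite mule_ge0 ?lee_fin ?power_lambda_ge0.
  - exact: measurable_funeM.
  rewrite integral_cst// [X in (s%:E * X)%E]probability_setT mule1.
  rewrite ge0_integralZl_EFin//; last first.
    by move=> t _; rewrite lee_fin power_lambda_ge0.
  by rewrite EFinD leeD2l// [leRHS]EFinM lee_wpmul2l// lee_fin.
split => //; apply/integrableP; split; first exact/measurable_EFinP.
by rewrite (le_lt_trans H)// ltry.
Qed.

End power_lambda.

(** * Deviations of sums of independent variables *)

Section iid.
Import HBNNSimple.
Context d (Omega : measurableType d) (R : realType) (P : probability Omega R).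
Context d' (T : measurableType d').

Let integral_indic_comp (Z : Omega -> T) (A : set T) : measurable_fun setT Z ->
  measurable A -> (\int[P]_w (\1_A (Z w))%:E = P (Z @^-1` A))%E.
Proof.
move=> mZ mA; rewrite -[in RHS](setTI (Z @^-1` A)) setIC.
rewrite -integral_indic//; last by rewrite -[X in measurable X]setTI; exact: mZ.
Qed.

Let measurable_indic_comp (Z : Omega -> T) (A : set T) : measurable_fun setT Z ->
  measurable A -> measurable_fun setT (fun w => \1_A (Z w) : R).
Proof.
by move=> mZ mA; apply: measurableT_comp => //; exact: measurable_indic.
Qed.

(** A product rule known for the indicators of [Z] extends to nonnegative [g] by simple functions
    and monotone convergence. In use, [Z0] has the law of [Z], and [c] is the mean of [W]. *)
Lemma factor_integral (W : Omega -> R) (Z Z0 : Omega -> T) (c : R) (g : T -> R) :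
    measurable_fun setT W -> (forall w, 0 <= W w) ->
    measurable_fun setT Z -> measurable_fun setT Z0 -> 0 <= c ->
    (forall A, measurable A ->
      (\int[P]_w (W w * \1_A (Z w))%:E = c%:E * P (Z0 @^-1` A))%E) ->
    measurable_fun setT g -> (forall z, 0 <= g z) ->
  (\int[P]_w (W w * g (Z w))%:E = c%:E * \int[P]_w (g (Z0 w))%:E)%E.
Proof.
move=> mW W0 mZ mZ0 c0 hA mg g0.
have mgE : measurable_fun setT (EFin \o g) by exact/measurable_EFinP.
pose h := nnsfun_approx measurableT mgE.
have cvg_h z : (h n z)%:E @[n --> \oo] --> (g z)%:E.
  by apply: cvg_nnsfun_approx => // ? _; rewrite lee_fin.
have nd_h z m n : (m <= n)%N -> h m z <= h n z.
  by move=> mn; have /lefP := nd_nnsfun_approx measurableT mgE mn; exact.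
have mh n (Y : Omega -> T) : measurable_fun setT Y -> measurable_fun setT (h n \o Y).
  by move=> mY; apply: measurableT_comp.
pose val_ n : seq R := fset_set (range (h n)).
have simple n : (\int[P]_w (W w * h n (Z w))%:E = c%:E * \int[P]_w (h n (Z0 w))%:E)%E.
  have mset y : measurable (h n @^-1` [set y]) by [].
  have hn0 i : 0 <= (val_ n)`_i.
    have [hi|hi] := ltnP i (size (val_ n)); last by rewrite nth_default.
    have : (val_ n)`_i \in fset_set (range (h n)) by exact: mem_nth.
    have fin : finite_set (range (h n)) by exact: fimfunP.
    by rewrite in_fset_set// => /set_mem[x _ <-].
  have m1 i (Y : Omega -> T) : measurable_fun setT Y -> measurable_fun setT
      (fun w => \1_(h n @^-1` [set (val_ n)`_i]) (Y w) : R).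
    by move=> mY; apply: measurable_indic_comp.
  have mW1 i : measurable_fun setT
      (fun w => (W w * \1_(h n @^-1` [set (val_ n)`_i]) (Z w))%:E).
    by apply/measurable_EFinP; apply: measurable_funM => //; exact: m1.
  have mZ1 i : measurable_fun setT
      (fun w => (\1_(h n @^-1` [set (val_ n)`_i]) (Z0 w) : R)%:E).
    by apply/measurable_EFinP; exact: m1.
  transitivity (\sum_(i < #|` fset_set (range (h n))|)
     ((val_ n)`_i)%:E *
     \int[P]_w (W w * \1_(h n @^-1` [set (val_ n)`_i]) (Z w))%:E)%E.
    transitivity (\sum_(i < #|` fset_set (range (h n))|)
       \int[P]_w (((val_ n)`_i)%:E * (W w * \1_(h n @^-1` [set (val_ n)`_i]) (Z w))%:E))%E.
      rewrite -ge0_integral_sum//=.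
      - apply: eq_integral => w _; rewrite (fimfunEord (h n)) sumEFin; congr EFin.
        by rewrite mulr_sumr; apply: eq_bigr => i _; rewrite mulrCA.
      - by move=> i; apply: measurable_funeM.
      - by move=> i w _; rewrite mule_ge0 ?lee_fin// mulr_ge0.
    apply: eq_bigr => i _; apply: ge0_integralZl_EFin => //.
    by move=> w _; rewrite lee_fin mulr_ge0.
  under eq_bigr => i _ do rewrite hA// muleCA.
  rewrite -ge0_sume_distrr; last by move=> i _; rewrite mule_ge0 ?lee_fin.
  congr (_ * _)%E.
  transitivity (\sum_(i < #|` fset_set (range (h n))|)
       \int[P]_w (((val_ n)`_i)%:E * (\1_(h n @^-1` [set (val_ n)`_i]) (Z0 w))%:E))%E.
    apply: eq_bigr => i _; rewrite -integral_indic_comp//; apply/esym.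
    by apply: ge0_integralZl_EFin => // w _; rewrite lee_fin.
  rewrite -ge0_integral_sum//=.
  - by apply: eq_integral => w _; rewrite (fimfunEord (h n)) sumEFin; congr EFin.
  - by move=> i; apply: measurable_funeM.
  - by move=> i w _; rewrite mule_ge0 ?lee_fin.
have cvgl : (\int[P]_w (W w * h n (Z w))%:E @[n --> \oo] -->
             \int[P]_w (W w * g (Z w))%:E)%E.
  under [X in _ --> X]eq_integral => w _.
    rewrite (_ : (W w * g (Z w))%:E = limn (fun n => (W w * h n (Z w))%:E)); last first.
      apply/esym/cvg_lim => //; have := cvgeZl (isT : (W w)%:E \is a fin_num) (cvg_h (Z w)).
      exact.
    over.
  apply: cvg_monotone_convergence => //.
  - by move=> n; apply/measurable_EFinP; apply: measurable_funM => //; exact: mh.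
  - by move=> n w _; rewrite lee_fin mulr_ge0.
  - by move=> w _ m n mn; rewrite lee_fin ler_wpM2l// nd_h.
have cvgr : (c%:E * \int[P]_w (h n (Z0 w))%:E @[n --> \oo] -->
             c%:E * \int[P]_w (g (Z0 w))%:E)%E.
  apply: cvgeZl => //.
  under [X in _ --> X]eq_integral => w _.
    rewrite (_ : (g (Z0 w))%:E = limn (fun n => (h n (Z0 w))%:E)); last first.
      by apply/esym/cvg_lim => //; exact: cvg_h.
    over.
  apply: cvg_monotone_convergence => //.
  - by move=> n; apply/measurable_EFinP; exact: mh.
  - by move=> n w _; rewrite lee_fin.
  - by move=> w _ m n mn; rewrite lee_fin nd_h.
apply: (cvg_unique _ cvgl) => //.
by apply: cvg_trans cvgr; apply: near_eq_cvg; near=> n; rewrite simple.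
Unshelve. all: by end_near.
Qed.

Variables (n : nat) (Z : 'I_n -> Omega -> T) (Z0 : Omega -> T).
Hypothesis mZ : forall i, measurable_fun setT (Z i).
Hypothesis mZ0 : measurable_fun setT Z0.
Hypothesis law : forall i (A : set T), measurable A -> P (Z i @^-1` A) = P (Z0 @^-1` A).
Hypothesis indep : forall A : 'I_n -> set T, (forall i, measurable (A i)) ->
  P (\bigcap_i (Z i @^-1` A i)) = (\prod_(i < n) P (Z i @^-1` A i))%E.

Lemma integral_prod_iid (g : 'I_n -> T -> R) :
    (forall i, measurable_fun setT (g i)) -> (forall i z, 0 <= g i z) ->
    (forall i, \int[P]_w (g i (Z0 w))%:E < +oo)%E ->
  (\int[P]_w (\prod_i g i (Z i w))%:E = \prod_i \int[P]_w (g i (Z0 w))%:E)%E.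
Proof.
(* Induction on the number [k] of leading indices at which [g] is arbitrary; at the others it is an
   indicator. For [k = 0] this is the product rule for events. *)
suff H k : (k <= n)%N -> forall (g : 'I_n -> T -> R),
    (forall i, measurable_fun setT (g i)) -> (forall i z, 0 <= g i z) ->
    (forall i, \int[P]_w (g i (Z0 w))%:E < +oo)%E ->
    (forall i : 'I_n, (k <= i)%N -> exists2 A, measurable A & g i = \1_A) ->
    (\int[P]_w (\prod_i g i (Z i w))%:E = \prod_i \int[P]_w (g i (Z0 w))%:E)%E.
  by move=> mg g0 gfin; apply: (H n) => // i; rewrite leqNgt ltn_ord.
elim: k => [_|k IHk kn] {}g mg g0 gfin gind.
  have /choice[A HA] : forall i, exists A : set T, measurable A /\ g i = \1_A.
    by move=> i; have [A mA gA] := gind i isT; exists A.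
  have mA i : measurable (A i) by have [] := HA i.
  transitivity (P (\bigcap_i (Z i @^-1` A i))).
    rewrite -[X in P X]setTI setIC -integral_indic//; last first.
      apply: fin_bigcap_measurable => // i _.
      by rewrite -[X in measurable X]setTI; exact: mZ.
    apply: eq_integral => w _; congr EFin; rewrite indicE.
    have [/mem_set wA|wA] := pselect ((\bigcap_i (Z i @^-1` A i)) w).
      rewrite wA big1// => i _; have [_ ->] := HA i.
      by rewrite indicE mem_set//; move/set_mem: wA; exact.
    have [i wAi] : exists i, ~ A i (Z i w).
      by apply/existsNP => wA'; apply: wA => i _; exact: wA'.
    rewrite (memNset wA) (bigD1 i)//=; have [_ ->] := HA i.
    by rewrite indicE memNset// mul0r.
  rewrite indep//; apply: eq_bigr => i _.
  have [_ ->] := HA i.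
  by rewrite law// integral_indic_comp.
pose k' := Ordinal kn.
rewrite (bigD1 k')//= muleC.
have fin_other : (\prod_(i | i != k') \int[P]_w (g i (Z0 w))%:E)%E \is a fin_num.
  apply: prode_fin_num => i _.
  by rewrite ge0_fin_numE// integral_ge0// => w _; rewrite lee_fin.
pose W w := \prod_(i | i != k') g i (Z i w).
rewrite -(fineK fin_other).
under eq_integral => w _ do rewrite (bigD1 k')//= mulrC -/(W w).
apply: factor_integral => //.
- rewrite (_ : W = fun w => \prod_(i <- [seq i <- index_enum 'I_n | i != k']) g i (Z i w)).
    by apply: measurable_prod => i _; apply: measurableT_comp.
  by apply/funext => w; rewrite big_filter.
- by move=> w; apply: prodr_ge0.
- apply: fine_ge0; apply: prode_ge0 => i _; apply: integral_ge0 => w _.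
  by rewrite lee_fin.
- move=> A mA; rewrite fineK//.
  (* With the new function replaced by an indicator, the induction hypothesis applies and gives the
     rule that [factor_integral] asks for. *)
  pose g' i := if i == k' then \1_A else g i.
  have g'N i : i != k' -> g' i = g i by rewrite /g' => /negbTE ->.
  have g'k : g' k' = \1_A by rewrite /g' eqxx.
  have g'E : (\int[P]_w (\prod_i g' i (Z i w))%:E =
              \prod_i \int[P]_w (g' i (Z0 w))%:E)%E.
    apply: IHk => [|i|i z|i|i ki]; first exact: ltnW.
    + by rewrite /g'; case: ifP.
    + by rewrite /g'; case: ifP.
    + rewrite /g'; case: ifP => // _.
      rewrite integral_indic_comp// (@le_lt_trans _ _ 1%E) ?ltry// probability_le1//.
      by rewrite -[X in measurable X]setTI; exact: mZ0.
    + have [->|ik] := eqVneq i k'; first by rewrite g'k; exists A.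
      rewrite g'N//; apply: gind; rewrite ltn_neqAle ki andbT.
      by apply: contra_neq ik => ki'; apply/val_inj.
  transitivity (\int[P]_w (\prod_i g' i (Z i w))%:E)%E.
    apply: eq_integral => w _; rewrite (bigD1 k')//= g'k mulrC /W.
    by congr (_ * _)%:E; apply: eq_bigr => i ik; rewrite g'N.
  rewrite g'E (bigD1 k')//= g'k integral_indic_comp// muleC.
  by congr (_ * _)%E; apply: eq_bigr => i ik; rewrite g'N.
Qed.

(* Chernoff's method: Markov's inequality for the product of the [g (Z i)]. *)
Lemma prob_prod_gt (g : T -> R) (m delta : R) :
    measurable_fun setT g -> (forall z, 0 <= g z) -> 0 < delta ->
    (\int[P]_w (g (Z0 w))%:E <= (expR m)%:E)%E ->
  (P [set w | (expR (n%:R * m) / delta < \prod_i g (Z i w))%R] <= delta%:E)%E.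
Proof.
move=> mg g0 d0 gm.
set t := expR (n%:R * m) / delta.
have t0 : 0 < t by rewrite divr_gt0 ?expR_gt0.
have mprod : measurable_fun setT (fun w => \prod_i g (Z i w)).
  by apply: measurable_prod => i _; apply: measurableT_comp.
have prod0 w : 0 <= \prod_i g (Z i w) by apply: prodr_ge0.
have int_le : (\int[P]_w (\prod_i g (Z i w))%:E <= (expR (n%:R * m))%:E)%E.
  rewrite (integral_prod_iid (g := fun=> g))//; last first.
    by move=> _; rewrite (le_lt_trans gm)// ltry.
  have int0 : (0 <= \int[P]_w (g (Z0 w))%:E)%E.
    by apply: integral_ge0 => w _; rewrite lee_fin.
  have int_fin : (\int[P]_w (g (Z0 w))%:E)%E \is a fin_num.
    by rewrite ge0_fin_numE// (le_lt_trans gm)// ltry.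
  rewrite -(fineK int_fin) prodEFin lee_fin prodr_const card_ord mulrC expRM_natr.
  rewrite lerXn2r ?nnegrE ?fine_ge0 ?expR_ge0//.
  by rewrite -lee_fin fineK.
have mA : measurable [set w | t < \prod_i g (Z i w)].
  rewrite -[X in measurable X]setTI.
  exact: (measurable_fun_ltr (measurable_cst t) mprod measurableT (Y := [set true])).
have : (t%:E * P [set w | (t < \prod_i g (Z i w))%R] <= (expR (n%:R * m))%:E)%E.
  apply: le_trans int_le.
  rewrite -(setTI [set w | _]) setIC -integral_indic//.
  rewrite -ge0_integralZl_EFin//; last 2 first.
  - by apply/measurable_EFinP; exact: measurable_indic.
  - exact: ltW.
  apply: ge0_le_integral => //.
  - by move=> w _; rewrite mule_ge0 ?lee_fin// ltW.
  - by apply: measurable_funeM; apply/measurable_EFinP; exact: measurable_indic.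
  - exact/measurable_EFinP.
  - move=> w _; rewrite -EFinM lee_fin indicE.
    have [/set_mem/= /ltW|_] := boolP (w \in [set w | t < \prod_i g (Z i w)]).
      by rewrite mulr1.
    by rewrite mulr0.
rewrite muleC -lee_pdivlMr// => /le_trans; apply.
rewrite /t -EFinM lee_fin invf_div mulrCA divff ?mulr1//.
by rewrite gt_eqF ?expR_gt0.
Qed.

Variable beta : R.
Hypothesis beta1 : 1 < beta.

(** The mean of [1 + a f + lambda (a f)] is at most [1 + a m + a^beta v], hence at most the
    exponential of [a m + a^beta v]. Off the event of [prob_prod_gt], logarithms are taken. *)
Lemma deviation (f : T -> R) (m v a delta : R) :
    measurable_fun setT f -> 0 <= a -> 0 < delta ->
    P.-integrable setT (fun w => (f (Z0 w))%:E) ->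
    (\int[P]_w (f (Z0 w))%:E = m%:E)%E ->
    (\int[P]_w (power_lambda beta (f (Z0 w)))%:E <= v%:E)%E ->
  exists B, [/\ measurable B, (P B <= delta%:E)%E &
    forall w, ~ B w ->
      \sum_(i < n) ln (1 + a * f (Z i w) + power_lambda beta (a * f (Z i w))) <=
      n%:R * (a * m + a `^ beta * v) - ln delta].
Proof.
move=> mf a0 d0 intf Ef Elam.
pose g z := 1 + a * f z + power_lambda beta (a * f z).
have g0 z : 0 < g z by exact: power_lambda_gt0.
have mlam : measurable_fun setT (fun w => (power_lambda beta (f (Z0 w)))%:E).
  apply/measurable_EFinP; apply: measurable_power_lambda.
  exact: (measurableT_comp mf).
have mg : measurable_fun setT g.
  apply: measurable_funD; last first.
    by apply: measurable_power_lambda; exact: measurable_funM.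
  by apply: measurable_funD => //; exact: measurable_funM.
pose B := [set w | expR (n%:R * (a * m + a `^ beta * v)) / delta < \prod_i g (Z i w)].
exists B; split.
- rewrite -[X in measurable X]setTI.
  apply: (measurable_fun_ltr (measurable_cst _) _ measurableT (Y := [set true])) => //.
  by apply: measurable_prod => i _; exact: (measurableT_comp mg).
- apply: prob_prod_gt => //; first by move=> z; exact: ltW.
  have gE w : (g (Z0 w))%:E =
      (1%:E + (a%:E * (f (Z0 w))%:E) + ((a `^ beta)%:E * (power_lambda beta (f (Z0 w)))%:E))%E.
    by rewrite -!EFinM -!EFinD /g power_lambdaM.
  under eq_integral => w _ do rewrite gE.
  have int1 : P.-integrable setT (fun w => 1%:E + a%:E * (f (Z0 w))%:E)%E.
    apply: integrableD => //; last exact: integrableZl.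
    exact: finite_measure_integrable_cst.
  have int2 : P.-integrable setT (fun w => (power_lambda beta (f (Z0 w)))%:E).
    apply/integrableP; split => //.
    under eq_integral => w _ do rewrite gee0_abs ?lee_fin ?power_lambda_ge0//.
    by rewrite (le_lt_trans Elam)// ltry.
  rewrite integralD//; last exact: integrableZl.
  rewrite integralD//; [|exact: finite_measure_integrable_cst|exact: integrableZl].
  rewrite integral_cst// [X in (1 * X)%E]probability_setT mule1 integralZl// integralZl// Ef.
  apply: (@le_trans _ _ (1 + a * m + a `^ beta * v)%:E).
    by rewrite !EFinD !EFinM leeD2l// lee_wpmul2l// ?lee_fin ?powR_ge0.
  by rewrite lee_fin -addrA expR_ge1Dx.
- move=> w /negP; rewrite -leNgt => prod_le.
  have -> : \sum_(i < n) ln (g (Z i w)) = ln (\prod_(i < n) g (Z i w)).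
    (* Positivity of the partial products is carried along, because [lnM] requires it. *)
    apply: esym; apply: proj2 (_ : 0 < \prod_(i < n) g (Z i w) /\ _).
    elim/big_rec2: _ => [|i x y _ [y0 <-]]; first by rewrite ln1.
    by split; [exact: mulr_gt0|rewrite lnM ?posrE].
  have -> : n%:R * (a * m + a `^ beta * v) - ln delta =
            ln (expR (n%:R * (a * m + a `^ beta * v)) / delta).
    by rewrite ln_div ?posrE ?expR_gt0// expRK.
  by rewrite ler_ln ?posrE ?prodr_gt0 ?divr_gt0 ?expR_gt0.
Qed.

End iid.

(** * Moments of the loss *)

Section problem.
Variables (R : realType) (n : nat) (M : problem R n) (beta : R).
Hypothesis beta1 : 1 < beta.
Hypothesis regM : regular_problem M (power_lambda beta).

Local Notation XY := (borel ('rV[R]_(dim_x M) * R)%type).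
Local Notation P := (Pr M).
Local Notation Rlam := (Rlam beta M).

Implicit Types theta : 'rV[R]_(dim_theta M).

Let beta0 : 0 < beta. Proof. exact: lt_trans beta1. Qed.

Lemma measurable_pairXY : measurable_fun setT (@pairXY _ _ M).
Proof. by have [[]] := regM. Qed.

Lemma measurable_lossXY theta : Theta M theta -> measurable_fun setT (lossXY theta).
Proof.
have [_ mloss _ _ _] := regM; move=> /mloss ml.
exact: (measurableT_comp ml measurable_pairXY).
Qed.

Lemma measurable_lipXY : measurable_fun setT (lipXY M).
Proof.
have [_ _ [_ ml] _ _] := regM.
exact: (measurableT_comp ml measurable_pairXY).
Qed.

Lemma lipXY_ge0 w : 0 <= lipXY M w.
Proof. by have [_ _ [l0 _] _ _] := regM; exact: l0. Qed.

Lemma lossXY_lip theta1 theta2 w : Theta M theta1 -> Theta M theta2 ->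
  `|lossXY theta2 w - lossXY theta1 w| <= lipXY M w * l2norm (theta2 - theta1).
Proof. by have [_ _ _ _ [lips _]] := regM; exact: lips. Qed.

Let lambda_risk_ge0 theta : (0 <= lambda_risk (power_lambda beta) theta :> \bar R)%E.
Proof. by apply: expectation_ge0 => w; exact: power_lambda_ge0. Qed.

Lemma Rlam_ge0 : 0 <= Rlam.
Proof.
have [[t tT]|no] := pselect (Theta M !=set0).
  apply: fine_ge0; apply: le_trans (lambda_risk_ge0 t) _.
  by apply: ereal_sup_ubound; exists t.
(* For an empty [Theta] the supremum is [-oo], and its [fine] is 0. *)
rewrite /Defs.Rlam /sup_lambda_risk (_ : Theta M = set0) ?image_set0 ?ereal_sup0//.
by apply/eqP; apply: contra_notT no => /set0P.
Qed.

(** The membership of [theta] makes the supremum nonnegative, hence finite, so that [fine] preserves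
    it. *)
Lemma integral_power_lambda_lossXY theta : Theta M theta ->
  (\int[P]_w (power_lambda beta (lossXY theta w))%:E <= Rlam%:E)%E.
Proof.
move=> tT; have [_ _ _ _ [_ sup_fin]] := regM.
have le_sup : (lambda_risk (power_lambda beta) theta <=
               sup_lambda_risk M (power_lambda beta))%E.
  by apply: ereal_sup_ubound; exists theta.
rewrite fineK; first by move: le_sup; rewrite /lambda_risk unlock.
by rewrite ge0_fin_numE// (le_trans _ le_sup)// lambda_risk_ge0.
Qed.

Lemma integrable_lossXY theta : Theta M theta ->
  P.-integrable setT (fun w => (lossXY theta w)%:E).
Proof.
move=> tT; have [] := integrable_power_lambda beta1 ltr01 (measurable_lossXY tT)
  (integral_power_lambda_lossXY tT); exact.
Qed.

Lemma integral_lossXY theta : Theta M theta ->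
  (\int[P]_w (lossXY theta w)%:E = (risk M theta)%:E)%E.
Proof.
move=> tT; rewrite /risk unlock fineK//.
by apply: integrable_fin_num => //; exact: integrable_lossXY.
Qed.

Lemma risk_le theta s : Theta M theta -> 0 < s ->
  `|risk M theta| <= s + s `^ (1 - beta) * beta * Rlam.
Proof.
move=> tT s0; rewrite -lee_fin -abse_EFin -integral_lossXY//.
have [intl le] := integrable_power_lambda beta1 s0 (measurable_lossXY tT)
  (integral_power_lambda_lossXY tT).
by apply: le_trans (le_abse_integral _ _ _) le => //; case/integrableP: intl.
Qed.

Lemma excess_risk_ge0 theta : Theta M theta -> 0 <= excess_risk theta.
Proof.
move=> tT; rewrite subr_ge0; apply: ge_inf; last by exists theta.
(* A real [inf] is a lower bound only of a set bounded below; [risk_le] at [s = 1] gives such a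
   bound. *)
exists (- (1 + 1 `^ (1 - beta) * beta * Rlam)) => _ [t tT' <-].
by have := risk_le tT' ltr01; rewrite ler_norml => /andP[].
Qed.

(** Holds at every parameter; it replaces the deviation bounds when the lambda-risk is zero or
    small. *)
Lemma excess_risk_le theta s : Theta M theta -> 0 < s ->
  excess_risk theta <= 2 * (s + s `^ (1 - beta) * beta * Rlam).
Proof.
move=> tT s0; rewrite lerBlDr -lerBlDl.
apply: lb_le_inf; first by exists (risk M theta), theta.
move=> _ [t tT' <-].
have := risk_le tT' s0; have := risk_le tT s0; rewrite !ler_norml.
by move=> /andP[_ ?] /andP[? _]; lra.
Qed.

Lemma excess_risk_argmin theta t : argmin (Theta M) (risk M) t ->
  excess_risk theta = risk M theta - risk M t.
Proof.
move=> [tT tmin]; congr (_ - _); apply/eqP; rewrite eq_le; apply/andP; split.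
  apply: ge_inf; last by exists t.
  by exists (risk M t) => _ [t' tT' <-]; exact: tmin.
by apply: lb_le_inf; [exists (risk M t), t|move=> _ [t' tT' <-]; exact: tmin].
Qed.

(** * Moments of the Lipschitz constant *)

Section lip.
Hypothesis lip_fin : (lip_moment beta M < +oo)%E.

Lemma lip_moment_ge0 : (0 <= lip_moment beta M)%E.
Proof. by apply: expectation_ge0 => w; exact: powR_ge0. Qed.

Lemma integral_power_lambda_lipXY :
  (\int[P]_w (power_lambda beta (lipXY M w))%:E =
   (fine (lip_moment beta M) / beta)%:E)%E.
Proof.
rewrite mulrC EFinM fineK ?ge0_fin_numE ?lip_moment_ge0// /lip_moment unlock.
rewrite -ge0_integralZl_EFin//; last 3 first.
- by move=> w _; rewrite lee_fin powR_ge0.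
- apply/measurable_EFinP.
  apply: (@measurableT_comp _ _ _ _ _ _ (@powR R ^~ beta)).
    exact: measurable_powR.
  exact: measurable_lipXY.
- by rewrite invr_ge0 ltW.
by apply: eq_integral => w _; rewrite -EFinM mulrC /power_lambda ger0_norm ?lipXY_ge0.
Qed.

Lemma integrable_lipXY : P.-integrable setT (fun w => (lipXY M w)%:E).
Proof.
have le : (\int[P]_w (power_lambda beta (lipXY M w))%:E <=
  (fine (lip_moment beta M) / beta)%:E)%E by rewrite integral_power_lambda_lipXY.
by have [] := integrable_power_lambda beta1 ltr01 measurable_lipXY le; exact.
Qed.

Lemma integral_lipXY : (\int[P]_w (lipXY M w)%:E = (fine (lip_mean M))%:E)%E.
Proof.
rewrite /lip_mean unlock fineK//.
by apply: integrable_fin_num => //; exact: integrable_lipXY.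
Qed.

Lemma lip_mean_ge0 : 0 <= fine (lip_mean M).
Proof. by apply: fine_ge0; apply: expectation_ge0; exact: lipXY_ge0. Qed.

Lemma lip_mean_le : fine (lip_mean M) <= 1 + fine (lip_moment beta M).
Proof.
rewrite -lee_fin -integral_lipXY.
have le : (\int[P]_w (power_lambda beta (lipXY M w))%:E <=
  (fine (lip_moment beta M) / beta)%:E)%E by rewrite integral_power_lambda_lipXY.
have [_] := integrable_power_lambda beta1 ltr01 measurable_lipXY le.
under eq_integral => w _ do rewrite gee0_abs ?lee_fin ?lipXY_ge0//.
by rewrite powR1 mul1r mulrCA divff ?mulr1// gt_eqF.
Qed.

Lemma risk_lip theta1 theta2 : Theta M theta1 -> Theta M theta2 ->
  risk M theta2 <= risk M theta1 + fine (lip_mean M) * l2norm (theta2 - theta1).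
Proof.
move=> t1 t2; set d := l2norm _.
rewrite -lee_fin EFinD mulrC EFinM -integral_lipXY -!integral_lossXY//.
rewrite -integralZl//; last exact: integrable_lipXY.
have intd : P.-integrable setT (fun w => d%:E * (lipXY M w)%:E)%E.
  by apply: integrableZl => //; exact: integrable_lipXY.
rewrite -integralD//; last exact: integrable_lossXY.
apply: le_integral => //.
- exact: integrable_lossXY.
- by apply: integrableD => //; exact: integrable_lossXY.
- move=> w _; rewrite -EFinM -EFinD lee_fin mulrC -lerBlDl.
  by rewrite (le_trans (ler_norm _))// lossXY_lip.
Qed.

Section lower.
Variables (theta : 'rV[R]_(dim_theta M)) (h : R).
Hypothesis thetaT : Theta M theta.
Hypothesis h0 : 0 <= h.

(** By the Lipschitz condition, its negative is below the loss at every parameter of [Theta] within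
    [h] of [theta]: one random variable serves a whole cell of the net. *)
Definition lower_loss (z : XY) : R := h * lip M z.2 z.1 - loss M z.2 z.1 theta.

Lemma measurable_lower_loss : measurable_fun setT lower_loss.
Proof.
have [_ ml [_ ml'] _ _] := regM.
by apply: measurable_funB; [exact: measurable_funM|exact: ml].
Qed.

Lemma integrable_lower_loss :
  P.-integrable setT (fun w => (lower_loss (pairXY w))%:E).
Proof.
apply: (@eq_integrable _ _ _ _ _ _ (fun w => h%:E * (lipXY M w)%:E - (lossXY theta w)%:E)%E) => //.
apply: integrableB => //; last exact: integrable_lossXY.
by apply: integrableZl => //; exact: integrable_lipXY.
Qed.

Lemma integral_lower_loss :
  (\int[P]_w (lower_loss (pairXY w))%:E = (h * fine (lip_mean M) - risk M theta)%:E)%E.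
Proof.
transitivity (\int[P]_w (h%:E * (lipXY M w)%:E - (lossXY theta w)%:E))%E.
  exact: eq_integral.
rewrite integralB//; [|by apply: integrableZl => //; exact: integrable_lipXY
  |exact: integrable_lossXY].
by rewrite integralZl// ?integral_lipXY ?integral_lossXY//; exact: integrable_lipXY.
Qed.

(** [power_lambdaD] separates the Lipschitz constant from the loss, at the price of the factor
    [2^(beta - 1)]. *)
Lemma integral_power_lambda_lower_loss :
  (\int[P]_w (power_lambda beta (lower_loss (pairXY w)))%:E <=
   (2 `^ (beta - 1) * (h `^ beta * (fine (lip_moment beta M) / beta) + Rlam))%:E)%E.
Proof.
have mlip : measurable_fun setT (fun w => (power_lambda beta (lipXY M w))%:E).
  by apply/measurable_EFinP/measurable_power_lambda; exact: measurable_lipXY.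
have mloss : measurable_fun setT (fun w => (power_lambda beta (lossXY theta w))%:E).
  by apply/measurable_EFinP/measurable_power_lambda; exact: measurable_lossXY.
have lam0 x : (0 <= (power_lambda beta x)%:E)%E by rewrite lee_fin power_lambda_ge0.
apply: (@le_trans _ _ (\int[P]_w ((2 `^ (beta - 1))%:E *
   ((h `^ beta)%:E * (power_lambda beta (lipXY M w))%:E +
    (power_lambda beta (lossXY theta w))%:E)))%E).
  apply: ge0_le_integral => //.
  - apply/measurable_EFinP; apply: measurable_power_lambda.
    exact: (measurableT_comp measurable_lower_loss measurable_pairXY).
  - apply: measurable_funeM; apply: emeasurable_funD => //.
    exact: measurable_funeM.
  - move=> w _; rewrite (_ : (_ * (_ * _ + _))%E = (2 `^ (beta - 1) *
      (power_lambda beta (h * lipXY M w) + power_lambda beta (- lossXY theta w)))%:E).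
      by rewrite lee_fin power_lambdaD.
    by rewrite power_lambdaM// power_lambdaN.
rewrite ge0_integralZl_EFin//; last 2 first.
- by move=> w _; rewrite adde_ge0// mule_ge0// lee_fin powR_ge0.
- by apply: emeasurable_funD => //; exact: measurable_funeM.
rewrite ge0_integralD//; last 2 first.
- by move=> w _; rewrite mule_ge0// lee_fin powR_ge0.
- exact: measurable_funeM.
rewrite ge0_integralZl_EFin//; last exact: powR_ge0.
rewrite integral_power_lambda_lipXY [leRHS]EFinM.
apply: lee_wpmul2l; first by rewrite lee_fin powR_ge0.
by rewrite EFinD; apply: leeD; [exact: lexx|exact: integral_power_lambda_lossXY].
Qed.

End lower.
End lip.
End problem.

(** * Excess risk for a fixed truncation level *)

Section inner_probability.
Context (R : realType) d (Omega : measurableType d) (P : probability Omega R).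
Implicit Types (q : R) (E : set Omega).

Lemma with_proba_ge_sub q q' E E' : q' <= q -> E `<=` E' ->
  with_proba_ge P q E -> with_proba_ge P q' E'.
Proof.
move=> qq EE' [A [mA AE qA]]; exists A; split => //; first exact: subset_trans EE'.
by apply: le_trans qA; rewrite lee_fin.
Qed.

Lemma with_proba_ge_setC q E B : measurable B -> ~` B `<=` E ->
  (P B <= (1 - q)%:E)%E -> with_proba_ge P q E.
Proof.
move=> mB BE PB; exists (~` B); split => //; first exact: measurableC.
rewrite probability_setC// leeBrDl ?fin_num_measure//.
by rewrite -leeBrDr// -EFinB.
Qed.

(* The witnesses need not be monotone; their upper limit is a witness for the
   intersection. *)
Lemma with_proba_ge_bigcap q (E : nat -> set Omega) : nonincreasing_seq E ->
  (forall k, with_proba_ge P q (E k)) -> with_proba_ge P q (\bigcap_k E k).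
Proof.
move=> decE /choice[A HA].
have mA k : measurable (A k) by have [] := HA k.
pose C m := \bigcup_(j in [set j | (m <= j)%N]) A j.
have mC m : measurable (C m) by apply: bigcup_measurable.
have mcap : measurable (\bigcap_m C m) by exact: bigcapT_measurable.
exists (\bigcap_m C m); split => //.
  move=> w Cw k _; have [j /= kj Aj] := Cw k I.
  by have [_ AE _] := HA j; exact: (subsetPset _ _ (decE _ _ kj)) (AE _ Aj).
(* Continuity from above: each [C m] contains [A m], so its probability is at least [q], and so is
   that of the limit. *)
have cvgC : P (C m) @[m --> \oo] --> P (\bigcap_m C m).
  apply: nonincreasing_cvg_mu => //.
    by rewrite (le_lt_trans (probability_le1 _ (mC 0%N)))// ltry.
  move=> m k mk; apply/subsetPset => w [j /= kj Aj]; exists j => //=.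
  exact: leq_trans kj.
rewrite -(cvg_lim _ cvgC)//; apply: lime_ge; first by apply/cvg_ex; exists (P (\bigcap_m C m)).
apply: nearW => m; have [_ _ qA] := HA m; apply: le_trans qA _.
by apply: le_measure; rewrite ?inE//; move=> w Aw; exists m => /=.
Qed.

End inner_probability.

(** * The penalized minimizer for a given truncation level *)

Section excess.
Variables (R : realType) (beta : R) (psi : R -> R).
Hypothesis beta1 : 1 < beta.
Hypothesis hpsi : truncation (power_lambda beta) psi.
Variables (n : nat) (M : problem R n).
Hypothesis n0 : (0 < n)%N.
Hypothesis regM : regular_problem M (power_lambda beta).
Hypothesis lip_fin : (lip_moment beta M < +oo)%E.

Local Notation XY := (borel ('rV[R]_(dim_x M) * R)%type).
Local Notation P := (Pr M).
Local Notation Rlam := (Rlam beta M).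
Local Notation EH := (fine (lip_mean M)).
Local Notation EHb := (fine (lip_moment beta M)).

(* The bound before [alpha] is optimized. *)
Definition excess_bound_at (alpha delta : R) : R :=
  2 * EH / n%:R
  + alpha `^ (beta - 1) * ((2 `^ (beta - 1) + 1) * Rlam
      + 2 `^ (beta - 1) / beta * (EHb * n%:R^-1 `^ beta))
  + complexity delta M / (n%:R * alpha).

Let psi_le x : psi x <= ln (1 + x + power_lambda beta x).
Proof. by have [_ /(_ x)/andP[_]] := hpsi; rewrite power_lambda_norm. Qed.

(** The lower envelope at [- x] is minus the upper envelope at [x], so [deviation] also serves for
    lower bounds. *)
Let psi_ge x : - ln (1 + x + power_lambda beta x) <= psi (- x).
Proof.
by have [_ /(_ (- x))/andP[+ _]] := hpsi; rewrite power_lambda_norm power_lambdaN opprK.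
Qed.

Variables (alpha delta rho : R) (thetahat : Omega M -> 'rV[R]_(dim_theta M)).
Hypothesis alpha0 : 0 < alpha.
Hypothesis delta0 : 0 < delta.
Hypothesis rho0 : 0 < rho.
Hypothesis hat : forall w, ridge_argmin psi alpha rho w (thetahat w).

Let sum_psi theta w := \sum_(i < n) psi (alpha * loss M (Ys M i w) (Xs M i w) theta).

Let deviationXY (f : XY -> R) (m v dlt : R) :
    measurable_fun setT f -> 0 < dlt ->
    P.-integrable setT (fun w => (f (pairXY w))%:E) ->
    (\int[P]_w (f (pairXY w))%:E = m%:E)%E ->
    (\int[P]_w (power_lambda beta (f (pairXY w)))%:E <= v%:E)%E ->
  exists B : set (Omega M), [/\ measurable B, (P B <= dlt%:E)%E &
    forall w, ~ B w ->
      \sum_(i < n) ln (1 + alpha * f (sampleXY i w) + power_lambda beta (alpha * f (sampleXY i w))) <=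
      n%:R * (alpha * m + alpha `^ beta * v) - ln dlt].
Proof.
move=> mf d0 intf Ef vf; have [[mZ0 mZ law indep] _ _ _ _] := regM.
by apply: (deviation mZ mZ0 law indep beta1) => //; exact: ltW.
Qed.

Lemma sum_psi_upper t : Theta M t ->
  exists B : set (Omega M), [/\ measurable B, (P B <= delta%:E)%E &
    forall w, ~ B w ->
      sum_psi t w <= n%:R * (alpha * risk M t + alpha `^ beta * Rlam) - ln delta].
Proof.
move=> tT; have [_ mloss _ _ _] := regM.
have [B [mB PB HB]] := deviationXY (mloss t tT) delta0 (integrable_lossXY beta1 regM tT)
  (integral_lossXY beta1 regM tT) (integral_power_lambda_lossXY beta1 regM tT).
exists B; split => // w Bw; apply: le_trans (HB w Bw).
by apply: ler_sum => i _; exact: psi_le.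
Qed.

(** A union bound over a [1/n]-net of [N] points, each at level [delta / N], brings in [ln N]. Of
    the two terms [EH / n], one is the mean of [lip / n] in [lower_loss], the other comes from
    replacing the risk at the net point by that at [theta]. *)
Lemma sum_psi_lower : exists B : set (Omega M), [/\ measurable B, (P B <= delta%:E)%E &
    forall w theta, ~ B w -> Theta M theta ->
      n%:R * (alpha * (risk M theta - 2 * EH / n%:R) - alpha `^ beta *
        (2 `^ (beta - 1) * (n%:R^-1 `^ beta * (EHb / beta) + Rlam))) + ln delta
      - (dim_theta M)%:R * ln (1 + 2 * n%:R * theta_radius M) <= sum_psi theta w].
Proof.
have n0R : 0 < n%:R :> R by rewrite ltr0n.
have [_ _ _ [_ r0 rad] _] := regM.
have e0 : 0 < n%:R^-1 :> R by rewrite invr_gt0.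
have [s [size_s sT net]] := exists_net e0 r0 rad.
set N := size s in size_s sT net.
have {}size_s : N%:R <= (1 + 2 * n%:R * theta_radius M) ^+ dim_theta M.
  by rewrite (le_trans size_s)// invrK -mulrA [theta_radius M * _]mulrC mulrA.
(* An empty net means an empty [Theta], and the claim is vacuous. *)
have [N0|N_gt0] := posnP N.
  exists set0; split => //; first by rewrite measure0 lee_fin ltW.
  by move=> w theta _ /net[i]; rewrite N0.
have N0R : 0 < N%:R :> R by rewrite ltr0n.
have /choice[B HB] : forall i, exists B : set (Omega M), [/\ measurable B,
    (P B <= (delta / N%:R)%:E)%E & (i < N)%N -> forall w, ~ B w ->
      \sum_(j < n) ln (1 + alpha * lower_loss s`_i n%:R^-1 (sampleXY j w)
          + power_lambda beta (alpha * lower_loss s`_i n%:R^-1 (sampleXY j w))) <=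
      n%:R * (alpha * (n%:R^-1 * EH - risk M s`_i) + alpha `^ beta *
         (2 `^ (beta - 1) * (n%:R^-1 `^ beta * (EHb / beta) + Rlam))) - ln (delta / N%:R)].
  move=> i; have [iN|Ni] := ltnP i N; last first.
    exists set0; split => //; first by rewrite measure0 lee_fin divr_ge0// ltW.
  have iT := sT i iN.
  have h0 : 0 <= n%:R^-1 :> R by rewrite invr_ge0.
  have [B [mB PB HB]] := deviationXY (measurable_lower_loss regM n%:R^-1 iT)
    (divr_gt0 delta0 N0R)
    (integrable_lower_loss beta1 regM lip_fin _ iT)
    (integral_lower_loss beta1 regM lip_fin _ iT)
    (integral_power_lambda_lower_loss beta1 regM lip_fin iT h0).
  by exists B; split => // _; exact: HB.
exists (\big[setU/set0]_(i < N) B i); split.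
- by apply: bigsetU_measurable => i _; have [] := HB i.
- apply: (@le_trans _ _ (\sum_(i < N) P (B i))%E).
    by apply: Boole_inequality => i _; have [] := HB i.
  apply: (@le_trans _ _ (\sum_(i < N) (delta / N%:R)%:E)%E).
    by apply: lee_sum => i _; have [] := HB i.
  by rewrite sumEFin lee_fin sumr_const card_ord -[leLHS]mulr_natr divfK// gt_eqF.
move=> w theta Bw tT; have [i iN dist] := net _ tT.
have iT := sT i iN.
have {}Bw : ~ B i w.
  by move=> Bi; apply: Bw; rewrite -bigcup_mkord; exists i.
have [_ _ /(_ iN w Bw) HBi] := HB i.
(* The loss at [theta] is at least minus [lower_loss] at the net point, and [psi] is monotone. *)
have lower j : - ln (1 + alpha * lower_loss s`_i n%:R^-1 (sampleXY j w)
          + power_lambda beta (alpha * lower_loss s`_i n%:R^-1 (sampleXY j w))) <=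
    psi (alpha * loss M (Ys M j w) (Xs M j w) theta).
  apply: le_trans (psi_ge _) _; have [psi_mono _] := hpsi; apply: psi_mono.
  rewrite -mulrN ler_pM2l// /lower_loss opprB /=.
  have [_ _ [lip0 _] _ [lips _]] := regM.
  have := lips (Ys M j w) (Xs M j w) _ _ iT tT; rewrite ler_norml => /andP[+ _].
  have : lip M (Ys M j w) (Xs M j w) * l2norm (theta - s`_i) <=
         n%:R^-1 * lip M (Ys M j w) (Xs M j w) by rewrite mulrC ler_wpM2r.
  by lra.
have : \sum_(j < n) - ln (1 + alpha * lower_loss s`_i n%:R^-1 (sampleXY j w)
          + power_lambda beta (alpha * lower_loss s`_i n%:R^-1 (sampleXY j w))) <=
       sum_psi theta w by apply: ler_sum => j _; exact: lower.
apply: le_trans; rewrite sumrN lerNr; apply: le_trans HBi _.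
have risk_i : risk M theta <= risk M s`_i + EH / n%:R.
  apply: le_trans (risk_lip beta1 regM lip_fin iT tT) _.
  by rewrite lerD2l ler_wpM2l// (lip_mean_ge0 regM).
have lnN : ln N%:R <= (dim_theta M)%:R * ln (1 + 2 * n%:R * theta_radius M).
  have b0 : 0 < 1 + 2 * n%:R * theta_radius M.
    by rewrite addr_gt0// !mulr_gt0.
  by rewrite mulr_natl -lnXn// ler_ln ?posrE ?exprn_gt0.
rewrite ln_div ?posrE//.
have : n%:R * (alpha * risk M theta) <= n%:R * (alpha * (risk M s`_i + EH / n%:R)).
  by rewrite !ler_pM2l.
have -> : 2 * EH / n%:R = 2 * (EH / n%:R) by rewrite mulrA.
rewrite [n%:R^-1 * EH]mulrC.
by lra.
Qed.

(** The upper bound at [t] and the lower bound at [thetahat w] are linked by the minimality of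
    [thetahat w]. They contribute 1 and [2^(beta - 1)] to the factor of [Rlam], and the two terms
    [- ln delta] make up [ln (delta^-2)] in the complexity. *)
Lemma excess_risk_deviation t : argmin (Theta M) (risk M) t ->
  with_proba_ge P (1 - 2 * delta)
    [set w | excess_risk (thetahat w) <=
             excess_bound_at alpha delta + rho * l2norm t ^+ 2].
Proof.
move=> tmin; have [tT _] := tmin.
have n0R : 0 < n%:R :> R by rewrite ltr0n.
have na0 : 0 < n%:R * alpha by rewrite mulr_gt0.
have [B1 [mB1 PB1 HB1]] := sum_psi_upper tT.
have [B2 [mB2 PB2 HB2]] := sum_psi_lower.
apply: (@with_proba_ge_setC _ _ _ _ _ _ (B1 `|` B2)).
- exact: measurableU.
- rewrite setCU => w [] B1w B2w /=.
  have [hT hmin] := hat w.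
  have := HB1 w B1w; have := HB2 w _ B2w hT; have := hmin t tT.
  rewrite /truncated_risk -/(sum_psi _ _) -/(sum_psi _ _) => ridge lo up.
  rewrite (excess_risk_argmin _ tmin).
  (* The penalty at [thetahat w] is nonnegative and is dropped. *)
  have {}ridge : sum_psi (thetahat w) w <= sum_psi t w + n%:R * alpha * (rho * l2norm t ^+ 2).
    rewrite -(ler_pM2l (x := (n%:R * alpha)^-1)) ?invr_gt0// mulrDr mulKf ?gt_eqF//.
    by apply: le_trans ridge; rewrite lerDl mulr_ge0 ?sqr_ge0// ltW.
  rewrite -(ler_pM2l na0).
  have -> : n%:R * alpha * (excess_bound_at alpha delta + rho * l2norm t ^+ 2) =
    n%:R * (alpha * (2 * EH / n%:R)) + n%:R * (alpha * alpha `^ (beta - 1)) *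
      ((2 `^ (beta - 1) + 1) * Rlam + 2 `^ (beta - 1) / beta * (EHb * n%:R^-1 `^ beta))
    + complexity delta M + n%:R * alpha * (rho * l2norm t ^+ 2).
    rewrite /excess_bound_at; field.
    by rewrite !gt_eqF// (lt_trans _ beta1).
  have -> : alpha * alpha `^ (beta - 1) = alpha `^ beta.
    rewrite -{1}(powRr1 (ltW alpha0)) -powRD ?subrKC//.
    by rewrite (gt_eqF alpha0) implybT.
  have -> : complexity delta M = - 2 * ln delta
      + (dim_theta M)%:R * ln (1 + 2 * n%:R * theta_radius M).
    by rewrite /complexity lnV ?posrE ?exprn_gt0// lnXn// mulr2n; ring.
  by lra.
- apply: le_trans (measureU2 _ _ _) _ => //.
  have -> : 1 - (1 - 2 * delta) = delta + delta by ring.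
  by rewrite EFinD leeD.
Qed.

Lemma excess_risk_deviation_inf :
  with_proba_ge P (1 - 2 * delta)
    [set w | ((excess_risk (thetahat w))%:E <= (excess_bound_at alpha delta)%:E
               + rho%:E * l2norm_minimizers M ^+ 2)%E].
Proof.
set m := l2norm_minimizers M.
have m0 : (0 <= m)%E.
  by apply: le_ereal_inf_tmp => _ [t _ <-]; rewrite lee_fin l2norm_ge0.
(* Without a minimizer the right-hand side is [+oo], as [rho > 0]. *)
have [minf|mfin] := eqVneq m +oo%E.
  exists setT; split => //; last first.
    by rewrite [leRHS]probability_setT lee_fin gerBl mulr_ge0// ltW.
  move=> w _ /=; rewrite minf ?expe2 mulyy gt0_muley ?lte_fin//.
  by rewrite addey ?leey.
have {}mfin : m \is a fin_num by rewrite ge0_fin_numE// ltey.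
pose mr := fine m.
have mr0 : 0 <= mr by exact: fine_ge0.
pose E k := [set w | excess_risk (thetahat w) <=
  excess_bound_at alpha delta + rho * mr ^+ 2 + k.+1%:R^-1].
have cap : with_proba_ge P (1 - 2 * delta) (\bigcap_k E k).
  apply: with_proba_ge_bigcap => [j k jk|k].
    apply/subsetPset => w /= /le_trans; apply.
    by rewrite lerD2l lef_pV2 ?posrE ?ltr0n// ler_nat ltnS.
  (* As [e <= 1], one has [(mr + e)^2 <= mr^2 + (2 mr + 1) e]; the other bound on [e] keeps [rho]
     times the error below [1/(k+1)]. *)
  pose e := Num.min 1 (k.+1%:R * (rho * (2 * mr + 1)))^-1.
  have c0 : 0 < rho * (2 * mr + 1) by rewrite mulr_gt0// ltr_pwDr// mulr_ge0.
  have e0 : 0 < e by rewrite lt_min ltr01/= invr_gt0 mulr_gt0// ltr0n.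
  have [_ [t tmin <-] te] := lb_ereal_inf_adherent e0 mfin.
  have {}te : l2norm t <= mr + e.
    by rewrite -lee_fin EFinD fineK// ltW.
  apply: with_proba_ge_sub (excess_risk_deviation tmin) => // w /= /le_trans; apply.
  rewrite -[leRHS]addrA lerD2l.
  apply: (@le_trans _ _ (rho * (mr + e) ^+ 2)).
    by rewrite ler_pM2l// ler_pXn2r ?nnegrE ?l2norm_ge0 ?addr_ge0// ltW.
  have e1 : e <= 1 by rewrite ge_min lexx.
  have ek : rho * (2 * mr + 1) * e <= k.+1%:R^-1.
    rewrite mulrC -ler_pdivlMr// -invfM ge_min -[X in _ || X]/(_ <= _).
    by rewrite lexx orbT.
  have : rho * (e * e) <= rho * (e * 1) by rewrite ler_pM2l// ler_wpM2l// ltW.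
  move=> ee; have -> : rho * (mr + e) ^+ 2 = rho * mr ^+ 2 +
      (rho * (2 * mr + 1) * e + (rho * (e * e) - rho * (e * 1))) by ring.
  by rewrite lerD2l -[leRHS]addr0 lerD// subr_le0.
apply: with_proba_ge_sub cap => // w /= Ew.
rewrite -(fineK mfin) -/mr ?expe2 -!EFinM -EFinD lee_fin -expr2.
apply/ler_addgt0Pr => e e0.
have [k ke] := ltr_add_invr e0.
by rewrite (le_trans (Ew k I))// lerD2l; rewrite add0r in ke; exact: ltW.
Qed.

End excess.

(** * The optimal truncation level *)

Lemma powR_inv (R : realType) (x r : R) : 0 < x -> x^-1 `^ r = (x `^ r)^-1.
Proof.
move=> x0; apply: (mulIf (x := x `^ r)); first by rewrite gt_eqF ?powR_gt0.
by rewrite -powRM ?invr_ge0 ?ltW// !mulVf ?gt_eqF ?powR_gt0// powR1.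
Qed.

Section optimal_alpha.
Variables (R : realType) (beta : R) (n : nat) (M : problem R n).
Hypothesis beta1 : 1 < beta.
Hypothesis n0 : (0 < n)%N.
Hypothesis regM : regular_problem M (power_lambda beta).

Local Notation Rlam := (Rlam beta M).
Local Notation c2 := (2 `^ (beta - 1) : R).
Local Notation A := ((c2 + 1) * Rlam).
Local Notation gam := ((beta - 1) / beta).

Let n0R : 0 < n%:R :> R. Proof. by rewrite ltr0n. Qed.
Let beta0 : 0 < beta. Proof. exact: lt_trans beta1. Qed.
Let gam0 : 0 < gam. Proof. by rewrite divr_gt0// subr_gt0. Qed.

Lemma complexity_ge (delta : R) : ln (delta ^- 2) <= complexity delta M.
Proof.
have [_ _ _ [_ r0 _] _] := regM.
by rewrite lerDl mulr_ge0// ln_ge0// lerDl !mulr_ge0// ltW.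
Qed.

Lemma ln_expNn2_gt (delta : R) : 0 < delta < 1 / 2 -> ln 4 < ln (delta ^- 2).
Proof.
move=> /andP[d0 d1]; rewrite ltr_ln ?posrE ?invr_gt0 ?exprn_gt0//.
rewrite -[4]invrK ltf_pV2 ?posrE ?invr_gt0 ?exprn_gt0//.
have -> : 4^-1 = (1 / 2) ^+ 2 :> R by field.
by rewrite ltr_pXn2r ?nnegrE// ltW.
Qed.

Lemma ln4_gt0 : 0 < ln 4 :> R.
Proof. by rewrite ln_gt0// ltr1n. Qed.

Lemma complexity_gt (delta : R) : 0 < delta < 1 / 2 -> ln 4 < complexity delta M.
Proof.
by move=> d; apply: lt_le_trans (complexity_ge _); exact: ln_expNn2_gt.
Qed.

Lemma complexity_gt0 (delta : R) : 0 < delta < 1 / 2 -> 0 < complexity delta M.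
Proof. by move=> /complexity_gt; apply: lt_trans; exact: ln4_gt0. Qed.

(** Only the first term depends on the level, and [delta < 1/2] keeps the complexity above [ln 4];
    so the factor depends on [delta'] alone, not on the problem. *)
Lemma complexity_change (delta delta' : R) : 0 < delta < 1 / 2 ->
  complexity delta' M <= (1 + `|ln (delta' ^- 2)| / ln 4) * complexity delta M.
Proof.
move=> d; have C0 := complexity_gt0 d.
have le1 : ln (delta' ^- 2) <= `|ln (delta' ^- 2)| / ln 4 * complexity delta M.
  apply: le_trans (ler_norm _) _; rewrite -mulrA ler_peMr//.
  by rewrite mulrC ler_pdivlMr ?ln4_gt0// mul1r ltW// complexity_gt.
have le2 : complexity delta' M - ln (delta' ^- 2) <= complexity delta M.
  rewrite /complexity addrAC subrr add0r lerDr.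
  by rewrite (le_trans _ (ltW (ln_expNn2_gt d)))// ltW// ln4_gt0.
by rewrite mulrDl mul1r; lra.
Qed.

Lemma rate_const_gt0 : 0 < c2 + 1.
Proof. by rewrite ltr_wpDl ?powR_ge0. Qed.

Lemma excess_const_num_ge0 :
  0 <= 2 * (c2 + 1) * Rlam + c2 / beta * fine (lip_moment beta M).
Proof.
have c20 : 0 <= c2 by exact: powR_ge0.
apply: addr_ge0; apply: mulr_ge0.
- by rewrite mulr_ge0// addr_ge0.
- exact: Rlam_ge0.
- by rewrite divr_ge0// ltW.
- by apply: fine_ge0; exact: lip_moment_ge0.
Qed.

Lemma excess_const_ge0 : 0 <= excess_const beta M.
Proof. by rewrite divr_ge0 ?powR_ge0// excess_const_num_ge0. Qed.

Lemma excess_bound_ge0 (delta : R) : 0 <= excess_bound beta delta M.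
Proof.
apply: addr_ge0; first by rewrite divr_ge0// mulr_ge0// (lip_mean_ge0 regM).
by rewrite mulr_ge0 ?powR_ge0// excess_const_ge0.
Qed.

Hypothesis Rlam0 : 0 < Rlam.

Let A0 : 0 < A. Proof. by rewrite mulr_gt0// rate_const_gt0. Qed.

Lemma alpha_optE (delta : R) : 0 < delta < 1 / 2 ->
  alpha_opt beta delta M = (complexity delta M / (n%:R * A)) `^ beta^-1.
Proof.
move=> d; have C0 := complexity_gt0 d.
rewrite /alpha_opt -powR_inv// -powRM ?invr_ge0// ?divr_ge0 ?ltW//.
by congr (_ `^ _); field; rewrite !gt_eqF// ?rate_const_gt0.
Qed.

Lemma alpha_opt_gt0 (delta : R) : 0 < delta < 1 / 2 -> 0 < alpha_opt beta delta M.
Proof.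
move=> d; rewrite alpha_optE// powR_gt0// divr_gt0 ?complexity_gt0// mulr_gt0//.
Qed.

(** With [A = (2^(beta - 1) + 1) Rlam] and [x = C / (n A)], the level [x^(1/beta)] balances the
    terms: [alpha^(beta - 1) A] and [C / (n alpha)] both equal [A x^gam]. The factor [k] pays for an
    analysis at a level [delta'] other than the tuning level [delta]. *)
Lemma excess_bound_at_opt (delta delta' k : R) : 0 < delta < 1 / 2 ->
    complexity delta' M <= k * complexity delta M ->
  excess_bound_at beta M (alpha_opt beta delta M) delta' <=
  2 * fine (lip_mean M) / n%:R
  + (complexity delta M / n%:R) `^ gam / A `^ gam *
    ((1 + k) * A + c2 / beta * (fine (lip_moment beta M) * n%:R^-1 `^ beta)).
Proof.
move=> d kC; have C0 := complexity_gt0 d.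
set x := complexity delta M / (n%:R * A).
have x0 : 0 < x by rewrite divr_gt0// mulr_gt0.
have alphaE : alpha_opt beta delta M = x `^ beta^-1 by exact: alpha_optE.
have a0 := alpha_opt_gt0 d.
have alpha_gam : alpha_opt beta delta M `^ (beta - 1) = x `^ gam.
  by rewrite alphaE -powRrM mulrC.
have xgam : (complexity delta M / n%:R) `^ gam / A `^ gam = x `^ gam.
  apply: (mulIf (x := A `^ gam)); first by rewrite gt_eqF ?powR_gt0.
  rewrite divfK ?gt_eqF ?powR_gt0// -powRM ?(ltW x0) ?(ltW A0)//.
  by congr (_ `^ _); rewrite /x; field; rewrite !gt_eqF// ?rate_const_gt0.
have CE : complexity delta M / (n%:R * alpha_opt beta delta M) = A * x `^ gam.
  have Cx : complexity delta M = n%:R * A * x.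
    by rewrite /x; field; rewrite !gt_eqF// ?rate_const_gt0.
  have xE : x = alpha_opt beta delta M * x `^ gam.
    rewrite alphaE -powRD.
      have -> : beta^-1 + gam = 1 by field; rewrite gt_eqF.
      by rewrite powRr1// ltW.
    by rewrite (gt_eqF x0) implybT.
  rewrite Cx {1}xE; field.
  by rewrite !gt_eqF.
rewrite xgam /excess_bound_at alpha_gam -addrA lerD2l.
have : complexity delta' M / (n%:R * alpha_opt beta delta M) <= k * (A * x `^ gam).
  by rewrite -CE mulrA ler_pM2r// invr_gt0 mulr_gt0.
by lra.
Qed.

End optimal_alpha.

(** * Risk bound at the optimal truncation level, consistency, and order of the bound *)

Section excess_bound.
Variables (R : realType) (beta : R) (psi : R -> R).
Hypothesis beta1 : 1 < beta.
Hypothesis hpsi : truncation (power_lambda beta) psi.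

(** [excess_risk_le] leaves only [2 s], with [s > 0] arbitrary. *)
Lemma excess_risk_Rlam0 n (M : problem R n) theta :
    regular_problem M (power_lambda beta) -> Rlam beta M = 0 ->
  Theta M theta -> excess_risk theta <= 0.
Proof.
move=> regM R0 tT; apply/ler_addgt0Pr => e e0.
have e20 : 0 < e / 2 by rewrite divr_gt0.
have := excess_risk_le beta1 regM tT e20.
by rewrite R0 mulr0 addr0 mulrC divfK// add0r.
Qed.

Lemma excess_risk_bound n (M : problem R n) (delta rho : R)
    (thetahat : Omega M -> 'rV[R]_(dim_theta M)) :
    (0 < n)%N -> regular_problem M (power_lambda beta) ->
    (lip_moment beta M < +oo)%E -> 0 < delta < 1 / 2 -> 0 < rho ->
    (forall w, ridge_argmin psi (alpha_opt beta delta M) rho w (thetahat w)) ->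
  with_proba_ge (Pr M) (1 - 2 * delta)
    [set w | ((excess_risk (thetahat w))%:E <=
              (excess_bound beta delta M)%:E + rho%:E * l2norm_minimizers M ^+ 2)%E].
Proof.
move=> n0 regM lipM d rho0 hat.
have n0R : 0 < n%:R :> R by rewrite ltr0n.
have beta0 : 0 < beta by exact: lt_trans beta1.
have C0 := complexity_gt0 regM d.
have EHb0 : 0 <= fine (lip_moment beta M) by apply: fine_ge0; exact: lip_moment_ge0.
have EH0 := lip_mean_ge0 regM.
have m0 : (0 <= l2norm_minimizers M)%E.
  by apply: le_ereal_inf_tmp => _ [t _ <-]; rewrite lee_fin l2norm_ge0.
(* If [Rlam = 0], then [alpha = 0]; the excess risk is then at most 0 everywhere, while the bound is
   nonnegative. *)
have := Rlam_ge0 M beta1; rewrite le_eqVlt => /predU1P[R0|R0].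
  exists setT; split => //; last first.
    case/andP: d => d0 _.
    by rewrite [leRHS]probability_setT lee_fin gerBl mulr_ge0// ltW.
  move=> w _ /=; have [hT _] := hat w.
  apply: (@le_trans _ _ 0%E).
    by rewrite lee_fin (excess_risk_Rlam0 regM _ hT).
  apply: adde_ge0; last by apply: mule_ge0; [rewrite lee_fin ltW|exact: mule_ge0].
  by rewrite lee_fin excess_bound_ge0.
case/andP: (d) => d0 _.
have := excess_risk_deviation_inf beta1 hpsi n0 regM lipM
  (alpha_opt_gt0 n0 regM R0 d) d0 rho0 hat.
apply: with_proba_ge_sub => // w /= /le_trans; apply.
apply: leeD => //; rewrite lee_fin.
apply: le_trans (excess_bound_at_opt (k := 1) beta1 n0 regM R0 d _) _; first by rewrite mul1r.
rewrite /excess_bound lerD2l /excess_const [leRHS]mulrC [leRHS]mulrA [leRHS]mulrAC.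
rewrite ler_wpM2l ?divr_ge0 ?powR_ge0//.
have -> : (1 + 1) * ((2 `^ (beta - 1) + 1) * Rlam beta M) =
          2 * (2 `^ (beta - 1) + 1) * Rlam beta M by ring.
rewrite lerD2l ler_wpM2l ?divr_ge0 ?powR_ge0 ?(ltW beta0)//.
(* The factor [n^(- beta) <= 1] at the moment of the Lipschitz constant is given away. *)
rewrite ler_piMr// powR_inv// invf_le1 ?powR_gt0//.
by rewrite -[leLHS](powRr0 n%:R) ler_powR ?ler1n// ltW.
Qed.

(** For large [n], the Lipschitz mean, the rate term and the penalty contribute at most [eps / 4]
    each. Here the factor [n^(- beta)] is kept: it absorbs the growth of the Lipschitz moment. *)
Lemma excess_risk_consistency (S : forall n, problem R n) (delta rho : nat -> R)
    (thetahat : forall n, Omega (S n) -> 'rV[R]_(dim_theta (S n))) (eps eta : R) :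
  (forall n, 0 < delta n < 1 / 2) ->
  (forall n, 0 < rho n) ->
  (forall n, (0 < n)%N -> regular_problem (S n) (power_lambda beta)) ->
  (forall n w, (0 < n)%N ->
     ridge_argmin psi (alpha_opt beta (delta n) (S n)) (rho n) w
       (thetahat n w)) ->
  (lip_mean (S n) * (n%:R^-1)%:E)%E @[n --> \oo] --> 0%E ->
  (exists K : R, \forall n \near \oo,
     (lip_moment beta (S n) <= (K * n%:R `^ beta)%:E)%E) ->
  (exists b : R, \forall n \near \oo, Rlam beta (S n) <= b) ->
  (complexity (delta n) (S n) / n%:R : R^o) @[n --> \oo] --> (0 : R^o) ->
  ((rho n)%:E * l2norm_minimizers (S n) ^+ 2)%E @[n --> \oo] --> 0%E ->
  0 < eps -> 0 < eta ->
  \forall n \near \oo, with_proba_ge (Pr (S n)) (1 - eta)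
    [set w | `|excess_risk (thetahat n w)| <= eps].
Proof.
move=> hd hrho reg hat lipm [K hK] [b hb] hC hm e0 eta0.
have beta0 : 0 < beta by exact: lt_trans beta1.
pose gam := (beta - 1) / beta.
have gam0 : 0 < gam by rewrite divr_gt0// subr_gt0.
pose c2 : R := 2 `^ (beta - 1).
have c20 : 0 < c2 by rewrite powR_gt0.
(* If the lambda-risk is at most [R0], then even [2 E|l| <= eps]. *)
pose s := eps / 4.
have s0 : 0 < s by rewrite divr_gt0.
pose R0 := s / (s `^ (1 - beta) * beta).
have R00 : 0 < R0 by rewrite divr_gt0// mulr_gt0// powR_gt0.
have small x : x <= R0 -> 2 * (s + s `^ (1 - beta) * beta * x) <= eps.
  move=> xR0; have : s `^ (1 - beta) * beta * x <= s.
    by rewrite mulrC -ler_pdivlMr// mulr_gt0// powR_gt0.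
  by rewrite /s; lra.
pose A0 := (c2 + 1) * R0.
have A00 : 0 < A0 by rewrite mulr_gt0// addr_gt0.
(* The deviation bound has probability [1 - 2 delta']; the factor [k] below is the one of
   [complexity_change]. *)
pose delta' := eta / 2.
have d'0 : 0 < delta' by rewrite divr_gt0.
pose k := 1 + `|ln (delta' ^- 2)| / ln 4 : R.
have k0 : 0 < k by rewrite ltr_pwDl// divr_ge0// ltW// ln4_gt0.
(* An eventual bound on the bracket in [excess_bound_at_opt]. *)
pose D := (1 + k) * ((c2 + 1) * `|b|) + c2 / beta * `|K|.
have D0 : 0 <= D.
  apply: addr_ge0; apply: mulr_ge0 => //.
  - by rewrite addr_ge0// ltW.
  - by rewrite mulr_ge0// addr_ge0// ltW.
  - by rewrite divr_ge0// ltW.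
(* Makes [u / A0^gam * D] at most [eps / 4]; the [+ 1] avoids dividing by [D = 0]. It is to bound
   [(C / n)^gam], hence the threshold [u^(1/gam)] for [C / n]. *)
pose u := eps / 4 * A0 `^ gam / (D + 1).
have u0 : 0 < u.
  by rewrite divr_gt0 ?ltr_wpDl// mulr_gt0 ?powR_gt0// divr_gt0.
have e80 : 0 < eps / 8 by rewrite divr_gt0.
have uE : u / A0 `^ gam * D <= eps / 4.
  have -> : u / A0 `^ gam * D = eps / 4 * (D / (D + 1)).
    by rewrite /u; field; rewrite !gt_eqF ?powR_gt0// ltr_wpDl.
  by rewrite ler_piMr ?divr_ge0 ?ltW// ltr_pdivrMr ?ltr_wpDl// mul1r ltrDl.
have nearC : \forall n \near \oo, complexity (delta n) (S n) / n%:R <= u `^ gam^-1.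
  have ug : 0 < u `^ gam^-1 by rewrite powR_gt0.
  have /cvgr_lt/(_ _ ug) := hC.
  by apply: filterS => n /ltW.
have near1 : \forall n \near \oo, (lip_mean (S n) * (n%:R^-1)%:E < (eps / 8)%:E)%E.
  apply: (lipm [set y | (y < (eps / 8)%:E)%E]); apply: open_nbhs_nbhs.
  by split; [exact: open_ereal_lt_ereal|rewrite /= lte_fin].
have near2 : \forall n \near \oo, ((rho n)%:E * l2norm_minimizers (S n) ^+ 2 < (eps / 4)%:E)%E.
  apply: (hm [set y | (y < (eps / 4)%:E)%E]); apply: open_nbhs_nbhs.
  by split; [exact: open_ereal_lt_ereal|rewrite /= lte_fin].
near=> n.
have n0 : (0 < n)%N by near: n; exists 1%N.
have n0R : 0 < n%:R :> R by rewrite ltr0n.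
have regM := reg n n0.
have d := hd n.
have C0 := complexity_gt0 regM d.
have KM : (lip_moment beta (S n) <= (K * n%:R `^ beta)%:E)%E by near: n.
have bM : Rlam beta (S n) <= b by near: n.
have CM : complexity (delta n) (S n) / n%:R <= u `^ gam^-1 by near: n.
have lM : (lip_mean (S n) * (n%:R^-1)%:E < (eps / 8)%:E)%E by near: n.
have mM : ((rho n)%:E * l2norm_minimizers (S n) ^+ 2 < (eps / 4)%:E)%E by near: n.
have lipM : (lip_moment beta (S n) < +oo)%E by rewrite (le_lt_trans KM)// ltry.
have hT w : Theta (S n) (thetahat n w) by have [] := hat n w n0.
have absE w : `|excess_risk (thetahat n w)| = excess_risk (thetahat n w).
  by rewrite ger0_norm// (excess_risk_ge0 beta1 regM).
have [Rsmall|Rlarge] := leP (Rlam beta (S n)) R0.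
  exists setT; split => //; last first.
    by rewrite [leRHS]probability_setT lee_fin gerBl ltW.
  move=> w _ /=; rewrite absE.
  exact: le_trans (excess_risk_le beta1 regM (hT w) s0) (small _ Rsmall).
have Rpos : 0 < Rlam beta (S n) by exact: lt_trans Rlarge.
have := excess_risk_deviation_inf beta1 hpsi n0 regM lipM
  (alpha_opt_gt0 n0 regM Rpos d) d'0 (hrho n) (fun w => hat n w n0).
apply: with_proba_ge_sub; first by rewrite /delta' mulrC divfK.
move=> w /= Hw; rewrite absE -lee_fin; apply: le_trans Hw _.
apply: (@le_trans _ _ ((eps / 2)%:E + (eps / 4)%:E)%E); last first.
  by rewrite -EFinD lee_fin; lra.
apply: leeD; last exact: ltW.
rewrite lee_fin.
apply: le_trans (excess_bound_at_opt beta1 n0 regM Rpos d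
  (complexity_change regM delta' d)) _.
have EHn : fine (lip_mean (S n)) / n%:R <= eps / 8.
  have lipE : lip_mean (S n) = (fine (lip_mean (S n)))%:E.
    by rewrite -(integral_lipXY beta1 regM lipM) /lip_mean unlock.
  by move: lM; rewrite lipE -EFinM lte_fin => /ltW.
have EHbn : fine (lip_moment beta (S n)) * n%:R^-1 `^ beta <= `|K|.
  rewrite powR_inv// ler_pdivrMr ?powR_gt0//.
  apply: (@le_trans _ _ (K * n%:R `^ beta)).
    by rewrite -lee_fin fineK// ge0_fin_numE ?lip_moment_ge0.
  by rewrite ler_wpM2r ?powR_ge0// ler_norm.
have ule : (complexity (delta n) (S n) / n%:R) `^ gam / ((c2 + 1) * Rlam beta (S n)) `^ gam
    <= u / A0 `^ gam.
  apply: ler_pM; rewrite ?invr_ge0 ?powR_ge0//.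
    have -> : u = (u `^ gam^-1) `^ gam.
      by rewrite -powRrM mulVf ?gt_eqF// powRr1// ltW.
    apply: ge0_ler_powR CM; rewrite ?nnegrE ?powR_ge0 ?(ltW gam0)//.
    by rewrite divr_ge0// ltW.
  rewrite lef_pV2 ?posrE ?powR_gt0//; last by rewrite mulr_gt0// addr_gt0.
  apply: ge0_ler_powR; rewrite ?nnegrE ?(ltW gam0) ?(ltW A00)//.
    by rewrite mulr_ge0 ?addr_ge0// ltW.
  by rewrite ler_pM2l ?addr_gt0// ltW.
have rest : (1 + k) * ((c2 + 1) * Rlam beta (S n)) + c2 / beta *
    (fine (lip_moment beta (S n)) * n%:R^-1 `^ beta) <= D.
  apply: lerD.
    apply: ler_wpM2l; first by rewrite addr_ge0// ltW.
    apply: ler_wpM2l; first by rewrite addr_ge0// ltW.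
    exact: le_trans bM (ler_norm _).
  by apply: ler_wpM2l => //; rewrite divr_ge0// ltW.
rewrite -/gam -/c2 -/k.
have : (complexity (delta n) (S n) / n%:R) `^ gam / ((c2 + 1) * Rlam beta (S n)) `^ gam *
   ((1 + k) * ((c2 + 1) * Rlam beta (S n)) + c2 / beta *
    (fine (lip_moment beta (S n)) * n%:R^-1 `^ beta)) <= eps / 4.
  apply: le_trans uE; apply: ler_pM => //.
  - by rewrite divr_ge0 ?powR_ge0.
  - apply: addr_ge0; apply: mulr_ge0.
    + by rewrite addr_ge0// ltW.
    + by rewrite mulr_ge0// ?addr_ge0// ltW.
    + by rewrite divr_ge0// ltW.
    + rewrite mulr_ge0 ?powR_ge0//.
      by apply: fine_ge0; exact: lip_moment_ge0.
by rewrite -[2 * _ / _]mulrA; lra.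
Unshelve. all: by end_near.
Qed.

End excess_bound.

(** With [p >= 1] and [n r >= c > 1], the quantity [p ln (n r)] stays above [ln c > 0] and absorbs
    the constants in the complexity. The lower bound on [Rlam] controls the denominator of
    [excess_const]. *)
Lemma excess_bound_bigO (R : realType) (beta : R) (beta1 : 1 < beta)
    (S : forall n, problem R n) (delta : R) : 0 < delta < 1 / 2 ->
  (forall n, (0 < n)%N -> regular_problem (S n) (power_lambda beta)) ->
  (exists K : R, \forall n \near \oo,
     (lip_moment beta (S n) <= K%:E)%E) ->
  (exists a b : R, 0 < a /\
     \forall n \near \oo, a <= Rlam beta (S n) <= b) ->
  (\forall n \near \oo, (0 < dim_theta (S n))%N) ->
  (exists c : R, 1 < c /\
     \forall n \near \oo, c <= n%:R * theta_radius (S n)) ->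
  (fun n => excess_bound beta delta (S n) : R^o) =O_\oo
  (fun n => ((dim_theta (S n))%:R * ln (n%:R * theta_radius (S n)) / n%:R)
              `^ ((beta - 1) / beta) : R^o).
Proof.
move=> d reg [K hK] [a [b [a0 hab]]] hp [c [c1 hc]].
have beta0 : 0 < beta by exact: lt_trans beta1.
set gam := (beta - 1) / beta.
have gam0 : 0 < gam by rewrite divr_gt0// subr_gt0.
have gam1 : gam <= 1 by rewrite ler_pdivrMr// mul1r gerBl.
pose c2 : R := 2 `^ (beta - 1).
have c20 : 0 < c2 by rewrite powR_gt0.
pose l := ln c.
have l0 : 0 < l by rewrite ln_gt0.
pose D0 := ln (delta ^- 2) : R.
have D00 : 0 < D0 by rewrite (lt_trans _ (ln_expNn2_gt d))// ln4_gt0.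
have ln30 : 0 < ln 3 :> R by rewrite ln_gt0// ltr1n.
(* Obtained from [1 + 2 x <= 3 x] for [x = n r >= 1], and from [p ln x >= l], [ln x >= l]. *)
pose K1 := D0 / l + (ln 3 / l + 1).
have K10 : 0 < K1 by rewrite addr_gt0 ?addr_gt0 ?divr_gt0.
pose num := 2 * (c2 + 1) * `|b| + c2 / beta * `|K|.
pose den := ((c2 + 1) * a) `^ gam.
have den0 : 0 < den by rewrite powR_gt0// mulr_gt0// addr_gt0.
have num0 : 0 <= num.
  by rewrite addr_ge0 ?mulr_ge0 ?addr_ge0 ?invr_ge0// ltW.
(* The first two summands are for the Lipschitz mean and the rate term; the 1 makes the constant
   positive. *)
apply/eqO_exP; exists (2 * (1 + `|K|) / l `^ gam + num / den * K1 `^ gam + 1).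
  have q1 : 0 <= 2 * (1 + `|K|) / l `^ gam.
    by rewrite divr_ge0 ?powR_ge0// mulr_ge0// addr_ge0.
  have q2 : 0 <= num / den * K1 `^ gam.
    by rewrite mulr_ge0 ?powR_ge0// divr_ge0// ltW.
  by rewrite ltr_wpDl// addr_ge0.
near=> n.
have n0 : (0 < n)%N by near: n; exists 1%N.
have n0R : 0 < n%:R :> R by rewrite ltr0n.
have n1R : 1 <= n%:R :> R by rewrite ler1n.
have regM := reg n n0.
have KM : (lip_moment beta (S n) <= K%:E)%E by near: n.
have lipM : (lip_moment beta (S n) < +oo)%E by rewrite (le_lt_trans KM)// ltry.
have /andP[aR bR] : a <= Rlam beta (S n) <= b by near: n.
have Rpos : 0 < Rlam beta (S n) by exact: lt_le_trans aR.
have p0 : (0 < dim_theta (S n))%N by near: n.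
have cr : c <= n%:R * theta_radius (S n) by near: n.
set p : R := (dim_theta (S n))%:R.
set x := n%:R * theta_radius (S n).
have p1 : 1 <= p by rewrite ler1n.
have x1 : 1 < x by exact: lt_le_trans cr.
have x0 : 0 < x by exact: lt_trans x1.
have lL : l <= ln x by rewrite ler_ln ?posrE// (lt_trans _ c1).
have L0 : 0 < ln x by exact: lt_le_trans lL.
have C0 := complexity_gt0 regM d.
set g := (p * ln x / n%:R) `^ gam.
have g0 : 0 <= g by exact: powR_ge0.
have EHb0 : 0 <= fine (lip_moment beta (S n)) by apply: fine_ge0; exact: lip_moment_ge0.
have EHbK : fine (lip_moment beta (S n)) <= `|K|.
  apply: le_trans (ler_norm _).
  by rewrite -lee_fin fineK// ge0_fin_numE ?lip_moment_ge0.
have EHK : fine (lip_mean (S n)) <= 1 + `|K|.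
  by rewrite (le_trans (lip_mean_le beta1 regM lipM))// lerD2l.
have EH0 := lip_mean_ge0 regM.
(* As [gam <= 1], [1/n <= (1/n)^gam], so the term of order [1/n] is within the rate. *)
have inv_n : n%:R^-1 <= g / l `^ gam.
  rewrite ler_pdivlMr ?powR_gt0//.
  apply: (@le_trans _ _ (n%:R^-1 `^ gam * l `^ gam)).
    rewrite ler_wpM2r ?powR_ge0// ger1_powR// invr_gt0 n0R/= invf_le1//.
  rewrite -powRM ?invr_ge0 ?(ltW l0)//.
  have t1 : 0 <= n%:R^-1 * l by rewrite mulr_ge0 ?invr_ge0// ltW.
  have t2 : 0 <= p * ln x / n%:R by rewrite divr_ge0// mulr_ge0// ltW.
  apply: ge0_ler_powR; rewrite ?nnegrE ?(ltW gam0)//.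
  rewrite mulrC ler_pM2r ?invr_gt0//.
  by rewrite (le_trans lL)// ler_peMl// ltW.
have C_le : complexity delta (S n) <= K1 * (p * ln x).
  have ln3 : ln (1 + 2 * n%:R * theta_radius (S n)) <= ln 3 + ln x.
    have pos : 0 < 1 + 2 * n%:R * theta_radius (S n) by rewrite -mulrA -/x; lra.
    have x30 : 0 < 3 * x by rewrite pmulr_rgt0.
    rewrite -lnM ?posrE// ler_ln ?posrE//.
    by rewrite -mulrA -/x; lra.
  have lnx : ln 3 <= ln 3 / l * ln x.
    by rewrite -mulrA ler_peMr ?(ltW ln30)// mulrC ler_pdivlMr// mul1r.
  have D0x : D0 <= D0 / l * (p * ln x).
    rewrite -mulrA ler_peMr ?(ltW D00)// mulrC ler_pdivlMr// mul1r.
    by rewrite (le_trans lL)// ler_peMl// ltW.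
  rewrite /K1 mulrDl; apply: lerD => //.
  rewrite mulrCA ler_wpM2l//; apply: le_trans ln3 _.
  by rewrite mulrDl mul1r lerD2r.
have rate : (complexity delta (S n) / n%:R) `^ gam <= K1 `^ gam * g.
  have t1 : 0 <= p * ln x / n%:R by rewrite divr_ge0// mulr_ge0// ltW.
  have t2 : 0 <= complexity delta (S n) / n%:R by rewrite divr_ge0// ltW.
  have t3 : 0 <= K1 * (p * ln x / n%:R) by rewrite mulr_ge0// ltW.
  rewrite -powRM ?(ltW K10)//.
  apply: ge0_ler_powR; rewrite ?nnegrE ?(ltW gam0)//.
  by rewrite !mulrA ler_pM2r ?invr_gt0// -mulrA.
have const_ge0 : 0 <= excess_const beta (S n) by exact: excess_const_ge0.
have const_le : excess_const beta (S n) <= num / den.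
  rewrite /excess_const; apply: ler_pM; rewrite ?invr_ge0 ?powR_ge0//.
  - exact: excess_const_num_ge0.
  - apply: lerD.
      by rewrite ler_pM2l ?mulr_gt0 ?addr_gt0// (le_trans bR)// ler_norm.
    by rewrite ler_wpM2l// divr_ge0// ltW.
  - have A0 : 0 < (c2 + 1) * a by rewrite mulr_gt0// addr_gt0.
    have A1 : 0 < (c2 + 1) * Rlam beta (S n) by rewrite mulr_gt0// addr_gt0.
    rewrite lef_pV2 ?posrE ?powR_gt0//.
    apply: ge0_ler_powR; rewrite ?nnegrE ?(ltW gam0) ?(ltW A0) ?(ltW A1)//.
    by rewrite ler_pM2l ?addr_gt0.
have bound_ge0 : 0 <= excess_bound beta delta (S n) by exact: excess_bound_ge0.
rewrite (ger0_norm bound_ge0) (ger0_norm g0).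
have part1 : 2 * fine (lip_mean (S n)) / n%:R <= 2 * (1 + `|K|) / l `^ gam * g.
  rewrite -[leRHS]mulrA [_^-1 * g]mulrC.
  by apply: ler_pM; rewrite ?mulr_ge0 ?invr_ge0 ?ler_pM2l.
have part2 : excess_const beta (S n) * (complexity delta (S n) / n%:R) `^ gam <=
    num / den * K1 `^ gam * g.
  by rewrite -[leRHS]mulrA; apply: ler_pM; rewrite ?powR_ge0.
apply: le_trans (lerD part1 part2) _.
by rewrite [leRHS]mulrDl mul1r -mulrDl lerDl.
Unshelve. all: by end_near.
Qed.

Theorem theorem4 (R : realType) (beta : R) (psi : R -> R)
    (hbeta : 1 < beta < 2)
    (hpsi : truncation (power_lambda beta) psi) :
  [/\ (* the excess risk bound, for each sample size *)
      forall (n : nat) (M : problem R n) (delta rho : R)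
          (thetahat : Omega M -> 'rV[R]_(dim_theta M)),
        (0 < n)%N ->
        regular_problem M (power_lambda beta) ->
        (lip_moment beta M < +oo)%E ->
        0 < delta < 1 / 2 ->
        0 < rho ->
        (forall w, ridge_argmin psi (alpha_opt beta delta M) rho w
                     (thetahat w)) ->
        with_proba_ge (Pr M) (1 - 2 * delta)
          [set w | ((excess_risk (thetahat w))%:E
                    <= (excess_bound beta delta M)%:E
                       + rho%:E * l2norm_minimizers M ^+ 2)%E],
      (* the order of the bound, along a sequence of problems *)
      forall (S : forall n, problem R n) (delta : R),
        0 < delta < 1 / 2 ->
        (forall n, (0 < n)%N -> regular_problem (S n) (power_lambda beta)) ->
        (exists K : R, \forall n \near \oo,
           (lip_moment beta (S n) <= K%:E)%E) ->
        (exists a b : R, 0 < a /\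
           \forall n \near \oo, a <= Rlam beta (S n) <= b) ->
        (\forall n \near \oo, (0 < dim_theta (S n))%N) ->
        (exists c : R, 1 < c /\
           \forall n \near \oo, c <= n%:R * theta_radius (S n)) ->
        (fun n => excess_bound beta delta (S n) : R^o) =O_\oo
        (fun n => ((dim_theta (S n))%:R * ln (n%:R * theta_radius (S n)) / n%:R)
                    `^ ((beta - 1) / beta) : R^o)
    & (* consistency, along a sequence of problems *)
      forall (S : forall n, problem R n) (delta rho : nat -> R)
          (thetahat : forall n, Omega (S n) -> 'rV[R]_(dim_theta (S n))),
        (forall n, 0 < delta n < 1 / 2) ->
        (forall n, 0 < rho n) ->
        (forall n, (0 < n)%N -> regular_problem (S n) (power_lambda beta)) ->
        (forall n w, (0 < n)%N ->
           ridge_argmin psi (alpha_opt beta (delta n) (S n)) (rho n) w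
             (thetahat n w)) ->
        (lip_mean (S n) * (n%:R^-1)%:E)%E @[n --> \oo] --> 0%E ->
        (exists K : R, \forall n \near \oo,
           (lip_moment beta (S n) <= (K * n%:R `^ beta)%:E)%E) ->
        (exists b : R, \forall n \near \oo, Rlam beta (S n) <= b) ->
        (complexity (delta n) (S n) / n%:R : R^o) @[n --> \oo] --> (0 : R^o) ->
        ((rho n)%:E * l2norm_minimizers (S n) ^+ 2)%E @[n --> \oo] --> 0%E ->
        forall eps eta : R, 0 < eps -> 0 < eta ->
          \forall n \near \oo,
            with_proba_ge (Pr (S n)) (1 - eta)
              [set w | `|excess_risk (thetahat n w)| <= eps]].
Proof.
have /andP[beta1 _] := hbeta; split.
- by move=> n M delta rho thetahat; exact: excess_risk_bound.
- by move=> S delta; exact: excess_bound_bigO.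
- move=> S delta rho thetahat hd hrho reg hat lipm hK hb hC hm eps eta.
  exact: (excess_risk_consistency beta1 hpsi hd hrho reg hat lipm hK hb hC hm).
Qed.
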